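(* Consider a parameterized circuit $U(x,\boldsymbol\Theta)=W_L(\boldsymbol\theta^{(L)})\,S(x)\,W_R(\boldsymbol\theta^{(R)})$ on $N$ qubits as described in the context, whose local blocks are general single-qubit rotations, with pure product initial state $\rho_0$ and observable $M$. Let $f(x)=\sum_{|\omega|\le N}c_\omega(\boldsymbol\Theta)e^{i\omega x}$ be its output. (a) Let $\omega\in\{1,\dots,N\}$. If $\mathbf{b}_{\omega,r}\ne0$ for some invariant plane $r$ at frequency $\omega$ at one parameter setting, then $c_\omega(\boldsymbol\Theta)\neq0$ at almost every parameter setting $\boldsymbol\Theta$. (b) Let $M=\hat Z_n$ and $W_L=W_L^{\mathrm{post}}\,U_{\mathrm{ent}}\,W_L^{\mathrm{pre}}$ with $\sin\gamma_{nk}\ne0$ for every $k\in\mathcal{N}(n)$. Then for every $\omega$ with $1\le\omega\le\deg(n)+1$ one has $\mathbf{b}_{\omega,r}\neq 0$ for some $r$ at some parameter setting, and hence $c_\omega(\boldsymbol\Theta)\ne0$ at almost every parameter setting.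
   Context: $\mathcal{H}=(\mathbb{C}^2)^{\otimes N}$; $X,Y,Z$ are Pauli matrices and $\hat A_n=I^{\otimes(n-1)}\otimes A\otimes I^{\otimes(N-n)}$. Inner product on operators: $\langle A,B\rangle=2^{-N}\mathrm{Tr}(A^\dagger B)$. Encoder: $G=\sum_{n=1}^N\hat X_n$, $S(x)=e^{-ixG/2}$. Circuit: the trainable blocks $W_L(\boldsymbol\theta^{(L)})$, $W_R(\boldsymbol\theta^{(R)})$ are products of fixed unitaries and gates $e^{-i\theta P/2}$, with $P$ a Pauli string and $\theta\in\mathbb{R}$ a trainable parameter; $\boldsymbol\Theta=(\boldsymbol\theta^{(L)},\boldsymbol\theta^{(R)})\in\mathbb{R}^p$. A layer of general single-qubit rotations is $\bigotimes_{j=1}^N R_Z(\alpha_j)R_Y(\beta_j)R_Z(\delta_j)$ with independent trainable angles, where $R_P(\theta)=e^{-i\theta P/2}$. The state-side block has the form $W_R=V\,W_R^{\mathrm{pre}}$, where $W_R^{\mathrm{pre}}$ (acting first on $\rho_0$) is a layer of general single-qubit rotations and $V$ is any product of fixed unitaries and gates $e^{-i\theta P/2}$ with $P$ a Pauli string and $\theta\in\mathbb{R}$ a trainable parameter. With $\rho=W_R\rho_0W_R^\dagger$ and $O=W_L^\dagger MW_L$ ($M$ Hermitian), the output is $f(x)=\mathrm{Tr}(\rho_0U^\dagger MU)=\mathrm{Tr}(\rho\,S(x)^\dagger O S(x))$, which is a Fourier series with frequencies $|\omega|\le N$ and coefficients $c_\omega(\boldsymbol\Theta)$. Invariant planes: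 with $E_j^\pm=\hat Z_j\pm i\hat Y_j$ and $c=(S_+,S_-,T)$ a triple of pairwise disjoint subsets of $\{1,\dots,N\}$, put $E_c=\prod_{j\in S_+}E_j^+\prod_{j\in S_-}E_j^-\prod_{j\in T}\hat X_j$ and $\omega(c)=|S_+|-|S_-|$. For $\omega\ge1$ enumerate the triples with $\omega(c)=\omega$ by $r$, and let $\mathcal{X}_{\omega,r}=E_c+E_c^\dagger$, $\mathcal{Y}_{\omega,r}=\frac1i(E_c-E_c^\dagger)$; the $r$-th plane is their span. $\mathbf{b}_{\omega,r}=(\langle O,\mathcal{X}_{\omega,r}\rangle,\langle O,\mathcal{Y}_{\omega,r}\rangle)$, which depends on $\boldsymbol\theta^{(L)}$. Entangler in (b): $\mathcal{G}=(V,E)$ is a simple graph on the qubits $\{1,\dots,N\}$, $\mathcal{N}(n)$ is the set of neighbours of $n$, $\deg(n)=|\mathcal{N}(n)|$, $\gamma_{nk}\in\mathbb{R}$ are fixed, $U_{\mathrm{ent}}=\exp\bigl(-\tfrac i2\sum_{k\in\mathcal{N}(n)}\gamma_{nk}\hat Z_n\hat Z_k\bigr)$, and $W_L^{\mathrm{post}},W_L^{\mathrm{pre}}$ are layers of general single-qubit rotations with independent angles. ''Almost every'' means outside a closed set of Lebesgue measure zero in $\mathbb{R}^p$. *)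

(* Defs.v *)
From HB Require Import structures.
From mathcomp Require Export all_boot all_order all_algebra.
From mathcomp Require Export complex.
From mathcomp Require Export all_classical all_reals all_analysis.
Export Order.TTheory GRing.Theory Num.Theory.
Export numFieldNormedType.Exports.

Set Implicit Arguments.
Unset Strict Implicit.
Unset Printing Implicit Defensive.

Export ComplexField.
Local Open Scope classical_set_scope.
Local Open Scope ring_scope.
Local Open Scope complex_scope.
Local Open Scope sesquilinear_scope.

(* Rows and columns of operators on (C^2)^{(x)N} are numbered by the
   computational basis kets |f>, f : {ffun 'I_N -> 'I_2}; qubits are numbered
   from 0. *)
Definition hdim (N : nat) : nat := #|{ffun 'I_N -> 'I_2}|.

Lemma hdimE N : hdim N = (2 ^ N)%N.
Proof. by rewrite /hdim card_ffun !card_ord. Qed.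

Definition ket N (a : 'I_(hdim N)) : {ffun 'I_N -> 'I_2} := enum_val a.

Notation operator R N := 'M[R[i]]_(hdim N).

Section Operators.
Variable R : realType.

(* Entrywise limit of the exponential series; a complex limit is taken on real
   and imaginary parts separately. *)
Definition expm d (A : 'M[R[i]]_d) : 'M[R[i]]_d :=
  \matrix_(a, b)
    (limn (series (fun k => complex.Re ((A ^+ k) a b / k`!%:R)) : R^nat)
     +i* limn (series (fun k => complex.Im ((A ^+ k) a b / k`!%:R)) : R^nat)).

Definition rotation d (P : 'M[R[i]]_d) (t : R) : 'M[R[i]]_d :=
  expm (- ('i * t%:C / 2) *: P).

Definition expi (t : R) : R[i] := cos t +i* sin t.

Definition mx2 (a b c d : R[i]) : 'M[R[i]]_2 :=
  \matrix_(r, s) if r == 0 then (if s == 0 then a else b)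
                 else (if s == 0 then c else d).

Inductive pauli := PauliI | PauliX | PauliY | PauliZ.

Definition pauli_mx (P : pauli) : 'M[R[i]]_2 :=
  match P with
  | PauliI => 1%:M
  | PauliX => mx2 0 1 1 0
  | PauliY => mx2 0 (- 'i) 'i 0
  | PauliZ => mx2 1 0 0 (- 1)
  end.

Section Qubits.
Variable N : nat.

Definition tens (A : 'I_N -> 'M[R[i]]_2) : operator R N :=
  \matrix_(a, b) \prod_j A j (ket a j) (ket b j).

Definition local_op (P : pauli) (n : 'I_N) : operator R N :=
  tens (fun j => if j == n then pauli_mx P else 1%:M).

Definition pauli_string (P : 'I_N -> pauli) : operator R N :=
  tens (fun j => pauli_mx (P j)).

Definition inner_op (A B : operator R N) : R[i] :=
  (2 ^+ N)^-1 * \tr (A ^t* *m B).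

Definition product_state (phi : 'I_N -> 'cV[R[i]]_2) : operator R N :=
  tens (fun j => phi j *m (phi j) ^t*).

Definition generator : operator R N := \sum_n local_op PauliX n.

Definition encoder (x : R) : operator R N := rotation generator x.

(* The first gate of a circuit is the leftmost factor of its operator.
   A trainable gate names the coordinate of the parameter vector it uses;
   several gates may use the same coordinate. *)
Inductive gate (p : nat) :=
  | FixedGate (U : operator R N) of U \is unitarymx
  | PauliGate (P : 'I_N -> pauli) (k : 'I_p).

Definition gate_op p (theta : 'rV[R]_p) (g : gate p) : operator R N :=
  match g with
  | FixedGate U _ => U
  | PauliGate P k => rotation (pauli_string P) (theta 0 k)
  end.

Definition circuit_op p (C : seq (gate p)) (theta : 'rV[R]_p) : operator R N :=
  \prod_(g <- C) gate_op theta g.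

(* The angles (alpha_j, beta_j, delta_j) are the coordinates of theta indexed
   by (j, 0), (j, 1), (j, 2). *)
Definition rotation_layer (theta : 'rV[R]_(N * 3)) : operator R N :=
  tens (fun j =>
    let angle k := theta 0 (mxvec_index j k) in
    rotation (pauli_mx PauliZ) (angle 0) *m
    rotation (pauli_mx PauliY) (angle 1) *m
    rotation (pauli_mx PauliZ) (angle 2%:R)).

Definition state_block pV (V : seq (gate pV)) (theta : 'rV[R]_(N * 3 + pV)) :
    operator R N :=
  circuit_op V (rsubmx theta) *m rotation_layer (lsubmx theta).

Definition observable (M W : operator R N) : operator R N := W ^t* *m M *m W.

Definition output (rho0 M WL WR : operator R N) (x : R) : R[i] :=
  let U := WL *m encoder x *m WR in \tr (rho0 *m U ^t* *m M *m U).

(* c lists the Fourier coefficients of f : f(x) = sum_{|w| <= N} c_w e^{iwx}. *)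
Definition fourier_expansion (f : R -> R[i]) (c : int -> R[i]) : Prop :=
  forall x : R,
    f x = \sum_(k < N.*2.+1)
            let w : int := k%:Z - N%:Z in c w * expi (w%:~R * x).

Definition ladder_plus (j : 'I_N) : operator R N :=
  local_op PauliZ j + 'i *: local_op PauliY j.

Definition ladder_minus (j : 'I_N) : operator R N :=
  local_op PauliZ j - 'i *: local_op PauliY j.

Record plane_index := PlaneIndex {
  Splus : {set 'I_N};
  Sminus : {set 'I_N};
  Sx : {set 'I_N}
}.

Definition plane_at (w : nat) (r : plane_index) : bool :=
  [&& [disjoint Splus r & Sminus r], [disjoint Splus r & Sx r],
      [disjoint Sminus r & Sx r]
    & #|Splus r|%:Z - #|Sminus r|%:Z == w%:Z :> int].

Definition plane_E (r : plane_index) : operator R N :=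
  (\prod_(j in Splus r) ladder_plus j) *m
  (\prod_(j in Sminus r) ladder_minus j) *m
  (\prod_(j in Sx r) local_op PauliX j).

Definition plane_X (r : plane_index) : operator R N :=
  plane_E r + (plane_E r) ^t*.

Definition plane_Y (r : plane_index) : operator R N :=
  'i^-1 *: (plane_E r - (plane_E r) ^t*).

(* Both entries are real when O is Hermitian; they are kept in R[i]. *)
Definition bvec (O : operator R N) (r : plane_index) : R[i] * R[i] :=
  (inner_op O (plane_X r), inner_op O (plane_Y r)).

Definition neighbours (e : rel 'I_N) (n : 'I_N) : {set 'I_N} :=
  [set k | e n k]%SET.

Definition entangler (e : rel 'I_N) (gamma : 'I_N -> 'I_N -> R) (n : 'I_N) :
    operator R N :=
  expm (- ('i / 2) *: \sum_(k in neighbours e n)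
          (gamma n k)%:C *: (local_op PauliZ n *m local_op PauliZ k)).

Definition star_block (e : rel 'I_N) (gamma : 'I_N -> 'I_N -> R) (n : 'I_N)
    (theta : 'rV[R]_(N * 3 + N * 3)) : operator R N :=
  rotation_layer (lsubmx theta) *m entangler e gamma n *m
  rotation_layer (rsubmx theta).

End Qubits.

(* p-dimensional Lebesgue measure, as the iterated product of
   lebesgue_measure; it is only evaluated on closed (hence Borel) sets. *)
Fixpoint lebesgue_tuple (p : nat) : set (p.-tuple R) -> \bar R :=
  match p with
  | 0 => dirac [tuple]
  | p'.+1 => pushforward (lebesgue_measure \x @lebesgue_tuple p')%E
               (fun u : R * p'.-tuple R => [tuple of u.1 :: u.2])
  end.

Definition lebesgue_rV p (A : set 'rV[R]_p) : \bar R :=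
  lebesgue_tuple [set t : p.-tuple R | A (\row_i tnth t i)].

Definition almost_every p (Q : 'rV[R]_p -> Prop) : Prop :=
  exists Z : set 'rV[R]_p,
    [/\ closed Z, lebesgue_rV Z = 0%E & forall theta, ~ Z theta -> Q theta].

End Operators.

(* Main.v *)
Require Import Defs.
From mathcomp Require Import ring.
Set Implicit Arguments.
Unset Strict Implicit.
Unset Printing Implicit Defensive.

(* With Pi_a = (x)_j (1 + (-1)^(a_j) X_j) / 2, the spectral projections of G,
   the encoder is diagonal and c_w = Tr(rho O_w), where O_w collects the blocks
   Pi_a O Pi_b with |b| = |a| + w.  Since [G, E_c] = -2w E_c, only these blocks
   contribute to Tr(O E_c), so b_{w,r} <> 0 forces O_w <> 0.  The single-qubit
   rotations reach every pure product state, and these span all operators, so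
   Tr(rho O_w) <> 0 for some angles.  Finally c_w is a polynomial in the
   exp(+-i theta_k / 2); by Tonelli and the finiteness of the roots of a
   univariate polynomial such a function vanishes almost nowhere unless it is
   identically zero.
   For (b), one layer turns Z_n into -X_n, and conjugation by the entangler maps
   X_n to |0><1| (x) D + |1><0| (x) D^-1 with
   D = (x)_k exp(i gamma_nk Z_k).  The other layer turns X_n into Z_n and some of
   the Z_k into X_k; against E_c with S_+ containing n, the first summand
   contributes 0 and the second a product of factors +-2i sin gamma_nk. *)

Local Open Scope classical_set_scope.
Local Open Scope ring_scope.
Local Open Scope complex_scope.
Local Open Scope sesquilinear_scope.

(** * Trigonometric polynomials and the size of their zero sets *)

Section TrigPoly.
Variable R : realType.

Lemma expiD (x y : R) : expi (x + y) = expi x * expi y.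
Proof.
rewrite /expi cosD sinD; apply/eqP; rewrite eq_complex /= eqxx /=.
by rewrite addrC eqxx.
Qed.

Lemma expi0 : expi (0 : R) = 1.
Proof. by rewrite /expi cos0 sin0. Qed.

Lemma expiNK (x : R) : expi (- x) * expi x = 1.
Proof. by rewrite -expiD addNr expi0. Qed.

Lemma expi_neq0 (x : R) : expi x != 0.
Proof. by apply/eqP=> h; move: (expiNK x); rewrite h mulr0 => /esym/eqP; rewrite oner_eq0. Qed.

Lemma expi_conj (x : R) : Num.conj (expi x) = expi (- x).
Proof. by rewrite /expi cosN sinN. Qed.

Lemma expiMn (x : R) n : expi (x *+ n) = expi x ^+ n.
Proof. by elim: n => [|n IH]; rewrite ?mulr0n ?expi0 // mulrS expiD IH exprS. Qed.

(** Half angles occur because gates are exponentials of [- i theta P / 2]. The class [X] of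
    admissible variables is a parameter, so that one notion serves functions of a real number, of a
    tuple and of a row vector. *)
Inductive trigpoly (T : Type) (X : (T -> R) -> Prop) : (T -> R[i]) -> Prop :=
| trigpoly_cst c : trigpoly X (fun=> c)
| trigpoly_expi x : X x -> trigpoly X (fun t => expi (x t / 2))
| trigpoly_expiN x : X x -> trigpoly X (fun t => expi (- (x t / 2)))
| trigpolyD f g : trigpoly X f -> trigpoly X g -> trigpoly X (fun t => f t + g t)
| trigpolyM f g : trigpoly X f -> trigpoly X g -> trigpoly X (fun t => f t * g t).

Lemma eq_trigpoly (T : Type) (X : (T -> R) -> Prop) (f g : T -> R[i]) :
  f =1 g -> trigpoly X f -> trigpoly X g.
Proof. by move=> /funext ->. Qed.

Lemma trigpoly_sum (T : Type) (X : (T -> R) -> Prop) (I : Type) (r : seq I)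
    (P : pred I) (F : I -> T -> R[i]) :
  (forall i, P i -> trigpoly X (F i)) ->
  trigpoly X (fun t => \sum_(i <- r | P i) F i t).
Proof.
move=> hF; elim: r => [|i r IH].
  by apply: eq_trigpoly (trigpoly_cst X _) => t; rewrite big_nil.
apply: (@eq_trigpoly _ _ (fun t => if P i then F i t + \sum_(j <- r | P j) F j t
    else \sum_(j <- r | P j) F j t)) => [t|]; first by rewrite big_cons.
by case Pi: (P i) => //; apply: trigpolyD => //; exact: hF.
Qed.

Lemma trigpoly_prod (T : Type) (X : (T -> R) -> Prop) (I : Type) (r : seq I)
    (P : pred I) (F : I -> T -> R[i]) :
  (forall i, P i -> trigpoly X (F i)) ->
  trigpoly X (fun t => \prod_(i <- r | P i) F i t).
Proof.
move=> hF; elim: r => [|i r IH].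
  by apply: eq_trigpoly (trigpoly_cst X _) => t; rewrite big_nil.
apply: (@eq_trigpoly _ _ (fun t => if P i then F i t * \prod_(j <- r | P j) F j t
    else \prod_(j <- r | P j) F j t)) => [t|]; first by rewrite big_cons.
by case Pi: (P i) => //; apply: trigpolyM => //; exact: hF.
Qed.

Lemma trigpoly_conj (T : Type) (X : (T -> R) -> Prop) (f : T -> R[i]) :
  trigpoly X f -> trigpoly X (fun t => Num.conj (f t)).
Proof.
elim=> [c|x Xx|x Xx|g h _ IHg _ IHh|g h _ IHg _ IHh].
- exact: trigpoly_cst.
- by apply: eq_trigpoly (trigpoly_expiN Xx) => t; rewrite expi_conj.
- by apply: eq_trigpoly (trigpoly_expi Xx) => t; rewrite expi_conj opprK.
- by apply: eq_trigpoly (trigpolyD IHg IHh) => t; rewrite rmorphD.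
- by apply: eq_trigpoly (trigpolyM IHg IHh) => t; rewrite rmorphM.
Qed.

(** A variable may become constant under [h]: this is what happens to a frozen coordinate when a
    function is restricted to a slice. *)
Lemma trigpoly_comp (T U : Type) (X : (T -> R) -> Prop) (Y : (U -> R) -> Prop)
    (h : U -> T) (f : T -> R[i]) :
  (forall x, X x -> Y (x \o h) \/ exists c, x \o h = cst c) ->
  trigpoly X f -> trigpoly Y (f \o h).
Proof.
move=> hX; elim=> [c|x Xx|x Xx|g k _ IHg _ IHk|g k _ IHg _ IHk].
- exact: trigpoly_cst.
- have [Yx|[c xc]] := hX _ Xx; first exact: (trigpoly_expi Yx).
  rewrite (_ : _ \o h = fun=> expi (c / 2)); first exact: trigpoly_cst.
  by apply/funext => u /=; rewrite -[x (h u)]/((x \o h) u) xc.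
- have [Yx|[c xc]] := hX _ Xx; first exact: (trigpoly_expiN Yx).
  rewrite (_ : _ \o h = fun=> expi (- (c / 2))); first exact: trigpoly_cst.
  by apply/funext => u /=; rewrite -[x (h u)]/((x \o h) u) xc.
- exact: (trigpolyD IHg IHk).
- exact: (trigpolyM IHg IHk).
Qed.

(** In one variable such a function is a Laurent polynomial in [expi (t / 2)]; the power [K] clears
    the negative exponents. *)
Lemma trigpoly_laurent (f : R -> R[i]) : trigpoly (eq id) f ->
  exists (Q : {poly R[i]}) (K : nat),
    forall t, f t * expi (t / 2) ^+ K = Q.[expi (t / 2)].
Proof.
elim=> [c|x <-|x <-|g h _ [Q [K hQ]] _ [S [L hS]]|g h _ [Q [K hQ]] _ [S [L hS]]].
- by exists c%:P, 0%N => t; rewrite hornerC mulr1.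
- by exists 'X, 0%N => t; rewrite hornerX mulr1.
- by exists 1, 1%N => t; rewrite hornerC expr1 expiNK.
- exists (Q * 'X^L + S * 'X^K), (K + L)%N => t.
  by rewrite !hornerE -hQ -hS exprD; ring.
- exists (Q * S), (K + L)%N => t.
  by rewrite !hornerE -hQ -hS exprD; ring.
Qed.

(* On each interval of length [pi] the cosine is injective. *)
Lemma countable_cos (c : R) : countable [set t : R | cos t = c].
Proof.
pose B (k : int) := [set t : R | k%:~R * pi <= t <= (k + 1)%:~R * pi /\ cos t = c].
apply: (@sub_countable _ _ _ (\bigcup_k B k)).
  apply: subset_card_le => t /= tc.
  exists (Num.floor (t / pi)) => //; split=> //.
  have /andP[tl tr] := floor_itv (t / pi).
  by rewrite -ler_pdivlMr ?pi_gt0 // tl -ler_pdivrMr ?pi_gt0 ?ltW.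
apply: bigcup_countable => // k _.
have [s ck] : exists s : R, forall t, cos (t - k%:~R * pi) = s * cos t.
  elim/int_rect: k => [|n [s hs]|n [s hs]].
  - by exists 1 => t; rewrite mul0r subr0 mul1r.
  - exists (- s) => t; rewrite mulNr -hs; apply: oppr_inj; rewrite opprK -cosDpi.
    by congr cos; rewrite -addn1 PoszD intrD; ring.
  - exists (- s) => t; rewrite [RHS]mulNr -hs -cosDpi; congr cos.
    by rewrite -addn1 PoszD opprD intrD; ring.
apply: finite_set_countable.
have [->|/set0P[t0 [/andP[t0l t0r] tc]]] := eqVneq (B k) set0.
  exact: finite_set0.
apply: (@sub_finite_set _ _ [set t0]); last exact: finite_set1.
move=> t [/andP[tl tr] tc'] /=.
suff : t - k%:~R * pi = t0 - k%:~R * pi by move/addIr.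
move: tr t0r; rewrite intrD mulrDl mul1r => tr t0r.
apply: cos_inj; rewrite ?in_itv /= ?subr_ge0 ?tl ?t0l ?lerBlDl ?tr ?t0r //.
by rewrite !ck tc tc'.
Qed.

(** A zero [t] makes [expi (t / 2)] one of the finitely many roots of a nonzero polynomial, and each
    root fixes the value of [cos (t / 2)], which leaves countably many [t]. *)
Lemma countable_trigpoly (f : R -> R[i]) :
  trigpoly (eq id) f -> (exists t, f t <> 0) -> countable [set t | f t = 0].
Proof.
move=> /trigpoly_laurent[Q [K hQ]] [t0 ft0].
have Q0 : Q != 0.
  apply/eqP => Q0; apply: ft0; move: (hQ t0); rewrite Q0 horner0.
  by move/eqP; rewrite mulf_eq0 expf_eq0 (negbTE (expi_neq0 _)) andbF orbF => /eqP.
have [r Qr] := closed_field_poly_normal Q.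
pose B (z : R[i]) := [set t : R | cos (t / 2) = complex.Re z].
apply: (@sub_countable _ _ _ (\bigcup_(z in [set` r]) B z)).
  apply: subset_card_le => t /= ft.
  have : Q.[expi (t / 2)] = 0 by rewrite -hQ ft mul0r.
  rewrite Qr hornerZ => /eqP; rewrite mulf_eq0 lead_coef_eq0 (negbTE Q0) /=.
  rewrite -/(root _ _) root_prod_XsubC => zr.
  by exists (expi (t / 2)).
apply: bigcup_countable => [|z _]; first exact: finite_set_countable.
have -> : B z = (fun t => t * 2) @` [set t : R | cos t = complex.Re z].
  apply/seteqP; split=> t /=.
    by move=> h; exists (t / 2) => //; rewrite divfK.
  by case=> u hu <-; rewrite /B /= mulfK.
by apply: (card_le_trans (card_image_le _ _)); exact: countable_cos.
Qed.

Definition tuple_coord p (x : p.-tuple R -> R) := exists k, x = fun t => tnth t k.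

(** Induction on the number of variables, slicing in the first one. All but countably many slices
    are nonzero functions, whose zero sets are null by induction; the other slices sit over a null
    set. *)
Lemma lebesgue_tuple_trigpoly p (f : p.-tuple R -> R[i]) :
  trigpoly (@tuple_coord p) f -> (exists t, f t <> 0) ->
  lebesgue_tuple [set t | f t = 0] = 0%E.
Proof.
elim: p f => [|p IH] f tf [t0 ft0].
  rewrite /= diracE memNset //= => h; apply: ft0; rewrite -h; congr f.
  by apply: tuple0.
rewrite /= /pushforward /product_measure1 /=.
pose g x := fun t' : p.-tuple R => f [tuple of x :: t'].
have tg x : trigpoly (@tuple_coord p) (g x).
  apply: (trigpoly_comp _ tf) => _ [k ->].
  case: (unliftP ord0 k) => [j ->|->].
    by left; exists j; apply/funext => t /=; rewrite tnthS.
  by right; exists x; apply/funext => t /=; rewrite tnth0.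
pose B := [set x | forall t', g x t' = 0].
have cB : countable B.
  (* This is the line through [t0] in the first direction. Its zeros contain [B], and it is not
     identically zero because it passes through [t0]. *)
  pose h x := f [tuple of x :: [tuple of behead t0]].
  apply: (@sub_countable _ _ _ [set x | h x = 0]).
    by apply: subset_card_le => x Bx; apply: Bx.
  apply: countable_trigpoly; last by exists (thead t0); rewrite /h -tuple_eta.
  apply: (trigpoly_comp _ tf) => _ [k ->].
  case: (unliftP ord0 k) => [j ->|->].
    by right; exists (tnth [tuple of behead t0] j); apply/funext => x /=; rewrite tnthS.
  by left; apply/funext => x /=; rewrite tnth0.
have mB : measurable (B : set (measurableTypeR R)).
  exact: countable_measurable.
(* The slice measure is the full measure on [B] and 0 elsewhere. The full measure may be infinite,
   but [B] is null and infinity times 0 is 0. *)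
transitivity (\int[lebesgue_measure]_(x in B)
    (cst (@lebesgue_tuple R p setT) x))%E; last first.
  rewrite integral_cst //; have B0 := countable_lebesgue_measure0 cB.
  by rewrite [X in (_ * X)%E]B0 mule0.
rewrite [RHS]integral_mkcond; apply: eq_integral => x _.
rewrite patchE; case: ifPn => [/set_mem Bx|/negP nBx].
  congr lebesgue_tuple; apply/seteqP; split=> t // _.
  by rewrite /xsection /= mem_set //; exact: Bx.
have [t gt] : exists t, g x t <> 0.
  apply: contrapT => h; apply: nBx; apply/mem_set => t.
  by apply: contrapT => gt; apply: h; exists t.
rewrite -[RHS](IH (g x)) //; last by exists t.
congr lebesgue_tuple; apply/seteqP; split=> u; rewrite /xsection /=.
  by move/set_mem.
by move=> h; apply/mem_set.
Qed.

Definition row_coord p (x : 'rV[R]_p -> R) := exists k, x = fun t => t 0 k.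

Lemma continuous_row_coord p (k : 'I_p) (g : R -> R) :
  continuous g -> continuous (fun t : 'rV[R]_p => g (t 0 k)).
Proof.
move=> cg t.
exact: (@continuous_comp _ _ _ (fun t : 'rV[R]_p => t 0 k) g t
  (@coord_continuous R _ _ _ _ t) (cg _)).
Qed.

(** Continuity of both parts makes the zero set closed, as [almost_every] demands. *)
Lemma continuous_trigpoly p (f : 'rV[R]_p -> R[i]) : trigpoly (@row_coord p) f ->
  continuous (fun t => complex.Re (f t)) /\ continuous (fun t => complex.Im (f t)).
Proof.
elim=> [c|_ [k ->]|_ [k ->]|g h _ [g1 g2] _ [h1 h2]|g h _ [g1 g2] _ [h1 h2]] /=.
- by split; exact: cst_continuous.
- have c2 : continuous (fun x : R => x / 2) by exact: mulrr_continuous.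
  split.
    apply: (@continuous_row_coord _ _ (fun x => cos (x / 2))) => x.
    exact: (@continuous_comp _ _ _ _ cos x (c2 x) (@continuous_cos R _)).
  apply: (@continuous_row_coord _ _ (fun x => sin (x / 2))) => x.
  exact: (@continuous_comp _ _ _ _ sin x (c2 x) (@continuous_sin R _)).
- have c2 : continuous (fun x : R => - (x / 2)).
    rewrite (_ : (fun _ => _) = *%R^~ (- 2^-1)); first exact: mulrr_continuous.
    by apply/funext => x; rewrite mulrN.
  split.
    apply: (@continuous_row_coord _ _ (fun x => cos (- (x / 2)))) => x.
    exact: (@continuous_comp _ _ _ _ cos x (c2 x) (@continuous_cos R _)).
  apply: (@continuous_row_coord _ _ (fun x => sin (- (x / 2)))) => x.
  exact: (@continuous_comp _ _ _ _ sin x (c2 x) (@continuous_sin R _)).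
- split.
    rewrite (_ : (fun _ => _) = (fun t => complex.Re (g t) + complex.Re (h t))).
      by move=> t; exact: (continuousD (g1 t) (h1 t)).
    by apply/funext => u; rewrite raddfD.
  rewrite (_ : (fun _ => _) = (fun t => complex.Im (g t) + complex.Im (h t))).
    by move=> t; exact: (continuousD (g2 t) (h2 t)).
  by apply/funext => u; rewrite raddfD.
- split.
    rewrite (_ : (fun _ => _) = (fun t => complex.Re (g t) * complex.Re (h t)
        - complex.Im (g t) * complex.Im (h t))).
      move=> t; apply: (continuousB (continuousM (g1 t) (h1 t))).
      exact: (continuousM (g2 t) (h2 t)).
    by apply/funext => u; case: (g u) => ? ?; case: (h u).
  rewrite (_ : (fun _ => _) = (fun t => complex.Re (g t) * complex.Im (h t)
        + complex.Im (g t) * complex.Re (h t))).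
    move=> t; apply: (continuousD (continuousM (g1 t) (h2 t))).
    exact: (continuousM (g2 t) (h1 t)).
  by apply/funext => u; case: (g u) => ? ?; case: (h u).
Qed.

Lemma almost_every_trigpoly p (f : 'rV[R]_p -> R[i]) :
  trigpoly (@row_coord p) f -> (exists t, f t <> 0) ->
  almost_every (fun t => f t <> 0).
Proof.
move=> tf [t0 ft0]; exists [set t | f t = 0]; split=> //.
- have [c1 c2] := continuous_trigpoly tf.
  have -> : [set t | f t = 0] = (fun t => complex.Re (f t)) @^-1` [set 0]
      `&` (fun t => complex.Im (f t)) @^-1` [set 0].
    apply/seteqP; split=> t /=; first by move=> ->.
    by case: (f t) => a b /= [-> ->].
  by apply: closedI; apply: preimage_closed => [t _|];
    [exact: c1|exact: closed_eq|exact: c2|exact: closed_eq].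
- rewrite /lebesgue_rV.
  apply: (@lebesgue_tuple_trigpoly p (fun t => f (\row_i tnth t i))).
    apply: (trigpoly_comp _ tf) => _ [k ->]; left; exists k.
    by apply/funext => t /=; rewrite mxE.
  exists [tuple t0 0 i | i < p]; rewrite (_ : \row_i _ = t0) //.
  by apply/rowP => i; rewrite mxE tnth_mktuple.
Qed.

End TrigPoly.

(** * Matrix exponentials from spectral decompositions *)

Section Exponential.
Variable R : realType.

Lemma mulii : 'i * 'i = -1 :> R[i].
Proof. by apply/eqP; rewrite eq_complex /= !mulr0 !mul0r sub0r !mulr1 !addr0 oppr0 !eqxx. Qed.

(** This matches the terms of the complex exponential series with those defining [cos] and [sin], so
    that the limits in [expm] become known functions. *)
Lemma expNi_coeff (x : R) k :
  (- ('i * x%:C)) ^+ k / k`!%:R = cos_coeff x k +i* - sin_coeff x k.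
Proof.
(* With [k] written as [b + m.*2], [b] its parity, the powers of [- 'i] reduce to [(-1) ^+ m] times
   1 or [- 'i]. *)
have e0 (b : bool) m : (- 'i) ^+ (b + m.*2) =
    ((~~ b)%:R * (-1) ^+ m) +i* (- (b%:R * (-1) ^+ m)) :> R[i].
  rewrite exprD -mul2n exprM sqrrN expr2 mulii.
  rewrite (_ : (-1 : R[i]) ^+ m = ((-1) ^+ m)%:C); last by rewrite rmorphXn rmorphN1.
  by case: b; apply/eqP; rewrite eq_complex /= ?expr0 ?expr1 /=;
    rewrite ?(mul0r, mul1r, mulr0, oppr0, subr0, sub0r, addr0, add0r, mulN1r) !eqxx.
have e : (- 'i) ^+ k = ((~~ odd k)%:R * (-1) ^ k./2) +i*
    (- ((odd k)%:R * (-1) ^+ k.-1./2)) :> R[i].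
  rewrite -[in LHS](odd_double_half k) e0; congr (_ +i* - _).
  (* [sin_coeff] uses [k.-1./2], which agrees with [k./2] for odd [k]; for even [k] the factor
     [odd k] is 0. *)
  case: (boolP (odd k)) => ok; last by rewrite !mul0r.
  by case: (k) ok => // n /=; rewrite uphalf_half => /negbTE ->.
rewrite -mulNr exprMn e -rmorphXn -[k`!%:R]/((k`!)%:R : R[i]).
rewrite (_ : (k`!%:R : R[i]) = (k`!%:R)%:C); last by rewrite rmorph_nat.
rewrite -fmorphV /cos_coeff /sin_coeff /=.
apply/eqP; rewrite eq_complex /= !(mulr0, mul0r, addr0, subr0, add0r).
by rewrite !mulNr !eqxx.
Qed.

Lemma cos_sin_series (I : finType) (l x y : I -> R) :
  limn (series (fun k => \sum_c (cos_coeff (l c) k * x c + sin_coeff (l c) k * y c)))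
  = \sum_c (cos (l c) * x c + sin (l c) * y c).
Proof.
apply/cvg_lim => //.
rewrite (_ : series _ = fun n => \sum_c (series (cos_coeff (l c)) n * x c
    + series (sin_coeff (l c)) n * y c)).
  apply: cvg_big => [|c _]; first exact: add_continuous.
  rewrite cos.unlock sin.unlock.
  by apply: cvgD; apply: cvgMr_tmp;
   [exact: is_cvg_series_cos_coeff|exact: is_cvg_series_sin_coeff].
apply/funext => n; rewrite /series /= exchange_big /=; apply: eq_bigr => c _.
by rewrite big_split /= !mulr_suml.
Qed.

Lemma ReD (z w : R[i]) : complex.Re (z + w) = complex.Re z + complex.Re w.
Proof. by case: z; case: w. Qed.

Lemma ImD (z w : R[i]) : complex.Im (z + w) = complex.Im z + complex.Im w.
Proof. by case: z; case: w. Qed.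

Lemma Re_sum (I : finType) (F : I -> R[i]) :
  complex.Re (\sum_c F c) = \sum_c complex.Re (F c).
Proof. exact: (big_morph _ ReD (erefl : complex.Re 0 = 0)). Qed.

Lemma Im_sum (I : finType) (F : I -> R[i]) :
  complex.Im (\sum_c F c) = \sum_c complex.Im (F c).
Proof. exact: (big_morph _ ImD (erefl : complex.Im 0 = 0)). Qed.

(** Once each power is a combination of the fixed matrices [B c], every entry of the exponential
    series splits into finitely many cosine and sine series. *)
Lemma expm_spectral (I : finType) d (A : 'M[R[i]]_d) (l : I -> R)
    (B : I -> 'M[R[i]]_d) :
  (forall k, A ^+ k = \sum_c (- ('i * (l c)%:C)) ^+ k *: B c) ->
  expm A = \sum_c expi (- l c) *: B c.
Proof.
move=> hA; apply/matrixP => a b; rewrite mxE summxE.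
have e k : (A ^+ k) a b / k`!%:R =
    \sum_c (cos_coeff (l c) k +i* - sin_coeff (l c) k) * B c a b.
  rewrite hA summxE mulr_suml; apply: eq_bigr => c _.
  by rewrite mxE mulrAC expNi_coeff.
rewrite (_ : (fun k => complex.Re _) = fun k => \sum_c (cos_coeff (l c) k *
    complex.Re (B c a b) + sin_coeff (l c) k * complex.Im (B c a b))); last first.
  apply/funext => k; rewrite e Re_sum; apply: eq_bigr => c _.
  by case: (B c a b) => u v /=; rewrite mulNr opprK.
rewrite (_ : (fun k => complex.Im _) = fun k => \sum_c (cos_coeff (l c) k *
    complex.Im (B c a b) + sin_coeff (l c) k * - complex.Re (B c a b))); last first.
  apply/funext => k; rewrite e Im_sum; apply: eq_bigr => c _.
  by case: (B c a b) => u v /=; rewrite mulNr mulrN.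
rewrite !cos_sin_series; apply/eqP; rewrite eq_complex /= Re_sum Im_sum.
by apply/andP; split; apply/eqP; apply: eq_bigr => c _; rewrite mxE /expi cosN sinN;
  case: (B c a b) => u v /=; rewrite ?mulNr ?opprK ?mulrN.
Qed.

(** Multiplying a power of [A] by the resolution of the identity lets it act on each [B c] by a
    power of its eigenvalue. *)
Lemma expm_eigen (I : finType) d (A : 'M[R[i]]_d) (l : I -> R)
    (B : I -> 'M[R[i]]_d) :
  \sum_c B c = 1%:M -> (forall c, A *m B c = - ('i * (l c)%:C) *: B c) ->
  expm A = \sum_c expi (- l c) *: B c.
Proof.
move=> sB hA; apply: expm_spectral => k.
have h c m : A ^+ m *m B c = (- ('i * (l c)%:C)) ^+ m *: B c.
  elim: m => [|m IH]; first by rewrite !expr0 scale1r; exact: mul1mx.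
  by rewrite exprS -[_ * _]/(_ *m _) -mulmxA IH -scalemxAr hA scalerA -exprSr.
by rewrite -[LHS]mulmx1 -sB mulmx_sumr; apply: eq_bigr => c _.
Qed.

End Exponential.

(** * Arithmetic of 2 by 2 matrices and Pauli matrices *)

Section TwoByTwo.
Variable R : realType.
Implicit Types a b c d x y z t : R[i].

Lemma mx2_eta (A : 'M[R[i]]_2) : A = mx2 (A 0 0) (A 0 1) (A 1 0) (A 1 1).
Proof.
apply/matrixP => r s; rewrite mxE.
have h (k : 'I_2) : k = if k == 0 then 0 else 1.
  by apply/val_inj; case: k => -[|[|]].
by rewrite [in LHS](h r) [in LHS](h s); case: (r == 0); case: (s == 0).
Qed.

Lemma mx2_scalar a : a%:M = mx2 a 0 0 a.
Proof. by rewrite [LHS]mx2_eta !mxE. Qed.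

Lemma mx2D a b c d x y z t :
  mx2 a b c d + mx2 x y z t = mx2 (a + x) (b + y) (c + z) (d + t).
Proof. by rewrite [LHS]mx2_eta !mxE. Qed.

Lemma mx2Z e a b c d : e *: mx2 a b c d = mx2 (e * a) (e * b) (e * c) (e * d).
Proof. by rewrite [LHS]mx2_eta !mxE. Qed.

Lemma mx2N a b c d : - mx2 a b c d = mx2 (- a) (- b) (- c) (- d).
Proof. by rewrite [LHS]mx2_eta !mxE. Qed.

Lemma mx2M a b c d x y z t :
  mx2 a b c d *m mx2 x y z t =
  mx2 (a * x + b * z) (a * y + b * t) (c * x + d * z) (c * y + d * t).
Proof. by rewrite [LHS]mx2_eta !mxE !big_ord_recl !big_ord0 !mxE /= !addr0. Qed.

Lemma mx2_adj a b c d :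
  (mx2 a b c d) ^t* = mx2 (Num.conj a) (Num.conj c) (Num.conj b) (Num.conj d).
Proof. by rewrite [LHS]mx2_eta !mxE. Qed.

Lemma mx2_tr a b c d : \tr (mx2 a b c d) = a + d.
Proof. by rewrite /mxtrace !big_ord_recl big_ord0 !mxE /= addr0. Qed.

Definition mx2E := (mx2_scalar, mx2D, mx2Z, mx2N, mx2M, mx2_adj).

Lemma conj_i : Num.conj 'i = - 'i :> R[i].
Proof. by apply/eqP; rewrite eq_complex /= oppr0 !eqxx. Qed.

Lemma conj_Ni : Num.conj (- 'i) = 'i :> R[i].
Proof. by apply/eqP; rewrite eq_complex /= opprK oppr0 !eqxx. Qed.

Lemma pauli_sqr P : pauli_mx R P *m pauli_mx R P = 1%:M.
Proof.
by case: P; rewrite ?mul1mx //= mx2_scalar !mx2E ?mulrNN ?mulNr ?mulrN ?mulii ?opprK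
  ?(mul0r, mulr0, addr0, add0r, mulr1) ?oppr0 ?opprK ?addr0.
Qed.

Lemma pauli_herm P : (pauli_mx R P) ^t* = pauli_mx R P.
Proof.
by case: P => /=; rewrite ?mx2_scalar !mx2E ?conj_i ?conj_Ni ?rmorphN ?rmorph0 ?rmorph1.
Qed.

End TwoByTwo.

(** * Tensor products and single-qubit operators *)

Section Tensor.
Variables (R : realType) (N : nat).
Implicit Types A B : 'I_N -> 'M[R[i]]_2.

Lemma eq_tens A B : A =1 B -> tens A = tens B.
Proof. by move=> /funext ->. Qed.

Lemma sum_ket (F : {ffun 'I_N -> 'I_2} -> R[i]) :
  \sum_(a < hdim N) F (ket a) = \sum_f F f.
Proof. by rewrite [RHS]big_enum_val. Qed.

Lemma ket_neq (a b : 'I_(hdim N)) : a != b -> exists j, ket a j != ket b j.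
Proof.
move=> ab; apply/existsP; rewrite -negb_forall; apply: contra ab => /forallP h.
by apply/eqP/enum_val_inj/ffunP => j; apply/eqP; exact: h.
Qed.

Lemma tensM A B : tens A *m tens B = tens (fun j => A j *m B j).
Proof.
apply/matrixP => a b; rewrite !mxE.
transitivity (\sum_c \prod_j (A j (ket a j) (ket c j) * B j (ket c j) (ket b j))).
  by apply: eq_bigr => c _; rewrite !mxE -big_split.
rewrite (sum_ket (fun f => \prod_j (A j (ket a j) (f j) * B j (f j) (ket b j)))).
rewrite -(bigA_distr_bigA (fun j k => A j (ket a j) k * B j k (ket b j))).
by apply: eq_bigr => j _; rewrite mxE.
Qed.

Lemma tens1 : tens (fun=> 1%:M) = 1%:M :> operator R N.
Proof.
apply/matrixP => a b; rewrite !mxE.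
have [->|ab] := eqVneq a b; first by apply: big1 => j _; rewrite mxE eqxx.
by have [j hj] := ket_neq ab; rewrite (bigD1 j) //= mxE (negbTE hj) mul0r.
Qed.

Lemma tens_adj A : (tens A) ^t* = tens (fun j => (A j) ^t*).
Proof.
apply/matrixP => a b; rewrite !mxE rmorph_prod.
by apply: eq_bigr => j _; rewrite !mxE.
Qed.

Lemma tr_tens A : \tr (tens A) = \prod_j \tr (A j).
Proof.
rewrite /mxtrace; transitivity (\sum_a \prod_j A j (ket a j) (ket a j)).
  by apply: eq_bigr => a _; rewrite mxE.
rewrite (sum_ket (fun f => \prod_j A j (f j) (f j))).
by rewrite -(bigA_distr_bigA (fun j k => A j k k)).
Qed.

Lemma tens_sum (I : finType) (F : 'I_N -> I -> 'M[R[i]]_2) :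
  tens (fun j => \sum_i F j i) =
  \sum_(f : {ffun 'I_N -> I}) tens (fun j => F j (f j)).
Proof.
apply/matrixP => a b; rewrite mxE summxE.
under eq_bigr do rewrite summxE.
rewrite bigA_distr_bigA; apply: eq_bigr => f _.
by rewrite mxE.
Qed.

Lemma tensZ (c : 'I_N -> R[i]) A :
  tens (fun j => c j *: A j) = (\prod_j c j) *: tens A.
Proof.
apply/matrixP => a b; rewrite !mxE -big_split /=.
by apply: eq_bigr => j _; rewrite mxE.
Qed.

Definition local (A : 'M[R[i]]_2) (n : 'I_N) : operator R N :=
  tens (fun j => if j == n then A else 1%:M).

Lemma localE (A : 'M[R[i]]_2) n a b :
  local A n a b = A (ket a n) (ket b n) * \prod_(j | j != n) (ket a j == ket b j)%:R.
Proof.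
rewrite mxE (bigD1 n) //= eqxx; congr (_ * _).
by apply: eq_bigr => j /negbTE ->; rewrite mxE.
Qed.

Lemma localD (A B : 'M[R[i]]_2) n : local (A + B) n = local A n + local B n.
Proof. by apply/matrixP => a b; rewrite [RHS]mxE !localE mxE mulrDl. Qed.

Lemma localZ c (A : 'M[R[i]]_2) n : local (c *: A) n = c *: local A n.
Proof. by apply/matrixP => a b; rewrite [RHS]mxE !localE mxE mulrA. Qed.

Lemma localM (A B : 'M[R[i]]_2) n : local A n *m local B n = local (A *m B) n.
Proof. by rewrite tensM; apply: eq_tens => j; case: eqP => // _; rewrite mulmx1. Qed.

Lemma local_comm (A B : 'M[R[i]]_2) m n : m != n ->
  local A m *m local B n = local B n *m local A m.
Proof.
move=> mn; rewrite !tensM; apply: eq_tens => j.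
have [->|_] := eqVneq j m; last by rewrite mul1mx mulmx1.
by rewrite (negbTE mn) mul1mx mulmx1.
Qed.

Lemma local_tens (A : 'M[R[i]]_2) n B : local A n *m tens B =
  tens (fun j => if j == n then A *m B j else B j).
Proof. by rewrite tensM; apply: eq_tens => j; case: eqP; rewrite ?mul1mx. Qed.

Lemma tens_local (A : 'M[R[i]]_2) n B : tens B *m local A n =
  tens (fun j => if j == n then B j *m A else B j).
Proof. by rewrite tensM; apply: eq_tens => j; case: eqP; rewrite ?mulmx1. Qed.

(** Matrix products do not commute, so the product over the set is treated as one over a
    duplicate-free list, where induction applies. *)
Lemma prod_local (S : {set 'I_N}) (A : 'M[R[i]]_2) :
  \prod_(j in S) local A j = tens (fun j => if j \in S then A else 1%:M).
Proof.
have : forall r : seq 'I_N, uniq r ->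
   \prod_(j <- r) local A j = tens (fun j => if j \in r then A else 1%:M).
  elim=> [|n r IH] /=; first by rewrite big_nil -[1]/(1%:M) -tens1.
  case/andP => nr ur; rewrite big_cons IH // -[_ * _]/(_ *m _) local_tens.
  apply: eq_tens => j; rewrite in_cons; case: eqP => [->|] //=.
  by rewrite (negbTE nr) mulmx1.
move=> h; rewrite -big_filter h ?filter_uniq ?index_enum_uniq //.
by apply: eq_tens => j; rewrite mem_filter mem_index_enum andbT.
Qed.

End Tensor.

(** * Diagonalisation of the encoder *)

Section Encoder.
Variables (R : realType) (N : nat).

Definition xproj1 (k : 'I_2) : 'M[R[i]]_2 :=
  2^-1 *: (1%:M + (-1) ^+ k *: pauli_mx R PauliX).

Definition xproj (a : 'I_(hdim N)) : operator R N :=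
  tens (fun j => xproj1 (ket a j)).

(** When [a] labels a joint eigenprojection of the X_j, this counts the sites with eigenvalue -1;
    the generator then takes the value [N - 2 * weight a]. *)
Definition weight (a : 'I_(hdim N)) : nat := (\sum_j ket a j)%N.

Lemma weight_le a : (weight a <= N)%N.
Proof.
rewrite -[leqRHS]card_ord -sum1_card; apply: leq_sum => j _.
by rewrite -ltnS ltn_ord.
Qed.

Lemma sum_xproj : \sum_a xproj a = 1%:M.
Proof.
rewrite -(@tens1 R N); transitivity (tens (fun _ : 'I_N => \sum_k xproj1 k)).
  rewrite tens_sum; apply/matrixP => a b; rewrite !summxE.
  by rewrite (sum_ket (fun f => tens (fun j => xproj1 (f j)) a b)).
apply: eq_tens => j; rewrite !big_ord_recl big_ord0 addr0 /xproj1 -scalerDr.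
rewrite /= expr0 [(-1) ^+ _]expr1 scale1r scaleN1r addrACA subrr addr0.
by rewrite scalerDr -scalerDl -[2^-1]mul1r -splitr scale1r.
Qed.

Lemma pauliX_xproj1 k : pauli_mx R PauliX *m xproj1 k = (-1) ^+ k *: xproj1 k.
Proof.
rewrite /xproj1 -!scalemxAr mulmxDr mulmx1 -scalemxAr pauli_sqr scalerA mulrC -scalerA.
congr (_ *: _); rewrite scalerDr scalerA -exprMn mulrNN mulr1 expr1n scale1r addrC.
by rewrite scalemx1.
Qed.

Lemma xproj1_pauliX k : xproj1 k *m pauli_mx R PauliX = (-1) ^+ k *: xproj1 k.
Proof.
rewrite -pauliX_xproj1 /xproj1 -scalemxAr -scalemxAl; congr (_ *: _).
by rewrite mulmxDl mulmxDr mul1mx mulmx1 -scalemxAl -scalemxAr.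
Qed.

Lemma local_scale (c : R[i]) (n : 'I_N) (B C : 'I_N -> 'M[R[i]]_2) :
  (forall j, B j = (if j == n then c else 1) *: C j) -> tens B = c *: tens C.
Proof.
move=> h; rewrite (eq_tens h) tensZ; congr (_ *: _).
by rewrite (bigD1 n) //= eqxx big1 ?mulr1 // => j /negbTE ->.
Qed.

Lemma localX_xproj n a :
  local (pauli_mx R PauliX) n *m xproj a = (-1) ^+ ket a n *: xproj a.
Proof.
rewrite local_tens; apply: (local_scale (n := n)) => j; case: eqP => [->|_].
  by rewrite pauliX_xproj1.
by rewrite scale1r.
Qed.

Lemma xproj_localX n a :
  xproj a *m local (pauli_mx R PauliX) n = (-1) ^+ ket a n *: xproj a.
Proof.
rewrite tens_local; apply: (local_scale (n := n)) => j; case: eqP => [->|_].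
  by rewrite xproj1_pauliX.
by rewrite scale1r.
Qed.

Lemma sum_sign a : \sum_(n < N) (-1) ^+ ket a n = N%:R - (weight a)%:R *+ 2 :> R[i].
Proof.
have -> : N%:R = \sum_(n < N) 1 :> R[i] by rewrite sumr_const card_ord.
rewrite natr_sum -sumrMnl -sumrB; apply: eq_bigr => n _.
case: (ket a n) => -[|[|]] //= _; first by rewrite mul0rn subr0.
by rewrite expr1 mulr2n opprD addrA subrr sub0r.
Qed.

Lemma generator_xproj a :
  generator R N *m xproj a = (N%:R - (weight a)%:R *+ 2) *: xproj a.
Proof.
rewrite mulmx_suml -sum_sign scaler_suml; apply: eq_bigr => n _.
exact: localX_xproj.
Qed.

Lemma xproj_generator a :
  xproj a *m generator R N = (N%:R - (weight a)%:R *+ 2) *: xproj a.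
Proof.
rewrite mulmx_sumr -sum_sign scaler_suml; apply: eq_bigr => n _.
exact: xproj_localX.
Qed.

Lemma encoderE x : encoder N x =
  \sum_a expi (- (x * (N%:R / 2 - (weight a)%:R))) *: xproj a.
Proof.
apply: expm_eigen => [|a]; first exact: sum_xproj.
rewrite -scalemxAl generator_xproj scalerA; congr (_ *: _).
rewrite rmorphM rmorphB /= fmorph_div /= !rmorph_nat.
by field.
Qed.

End Encoder.

(** * Adjoints and traces *)

Section Adjoint.
Variable R : realType.

Lemma adjM m n p (A : 'M[R[i]]_(m, n)) (B : 'M[R[i]]_(n, p)) :
  (A *m B) ^t* = B ^t* *m A ^t*.
Proof. by rewrite trmx_mul map_mxM. Qed.

Lemma adjD m n (A B : 'M[R[i]]_(m, n)) : (A + B) ^t* = A ^t* + B ^t*.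
Proof. by rewrite linearD map_mxD. Qed.

Lemma adjZ m n c (A : 'M[R[i]]_(m, n)) : (c *: A) ^t* = Num.conj c *: A ^t*.
Proof. by rewrite linearZ map_mxZ. Qed.

Lemma adj_sum m n (I : finType) (A : I -> 'M[R[i]]_(m, n)) :
  (\sum_k A k) ^t* = \sum_k (A k) ^t*.
Proof. by rewrite linear_sum map_mx_sum. Qed.

Lemma adjK m n (A : 'M[R[i]]_(m, n)) : (A ^t*) ^t* = A.
Proof. by apply/matrixP => i j; rewrite !mxE conjCK. Qed.

Lemma tr_adj n (A : 'M[R[i]]_n) : \tr (A ^t*) = Num.conj (\tr A).
Proof. by rewrite -mxtrace_tr /mxtrace rmorph_sum; apply: eq_bigr => i _; rewrite !mxE. Qed.

Lemma tr_sum n (I : finType) (P : pred I) (A : I -> 'M[R[i]]_n) :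
  \tr (\sum_(k | P k) A k) = \sum_(k | P k) \tr (A k).
Proof. exact: raddf_sum. Qed.

(** Cyclicity of the trace moves the right block onto the state and the left block onto the
    observable. *)
Lemma trace_sandwich n (r M L S W : 'M[R[i]]_n) :
  \tr (r *m (L *m S *m W) ^t* *m M *m (L *m S *m W)) =
  \tr (W *m r *m W ^t* *m (S ^t* *m (L ^t* *m M *m L) *m S)).
Proof. by rewrite !adjM !mulmxA mxtrace_mulC !mulmxA. Qed.

End Adjoint.

(** * Fourier coefficients and invariant planes *)

Section Fourier.
Variable R : realType.

Lemma expiX (x : R) n : expi x ^+ n = expi (n%:R * x).
Proof. by rewrite mulr_natl expiMn. Qed.

(** A nonzero difference would have more roots on the unit circle than its degree allows. *)
Lemma eq_poly_expi (p q : {poly R[i]}) :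
  (forall x : R, p.[expi x] = q.[expi x]) -> p = q.
Proof.
move=> pq; apply/eqP; rewrite -subr_eq0; apply/negPn/negP => d0.
set s := size (p - q).
(* The angles [j / s.+1] lie between 0 and 1, inside the interval from 0 to [pi] where the cosine is
   injective, so these are [s.+1] distinct points. *)
pose g (j : nat) : R[i] := expi (j%:R / s.+1%:R).
have ug : uniq [seq g j | j <- iota 0 s.+1].
  rewrite map_inj_in_uniq ?iota_uniq // => i j.
  rewrite !mem_iota !add0n => /andP[_ ilt] /andP[_ jlt] [ij _].
  have itv (k : nat) : (k < s.+1)%N -> k%:R / s.+1%:R \in `[0, pi : R].
    move=> ks; rewrite in_itv /= divr_ge0 //= (@le_trans _ _ 1) //.
      by rewrite ler_pdivrMr ?ltr0Sn // mul1r ler_nat ltnW.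
    by apply: le_trans (pi_ge2 R); rewrite ler1n.
  move/(cos_inj (itv _ ilt) (itv _ jlt)): ij => /(mulIf _) h.
  by apply/eqP; rewrite -(eqr_nat R) h // invr_eq0 pnatr_eq0.
have : (size [seq g j | j <- iota 0 s.+1] < s)%N.
  apply: max_poly_roots => //; apply/allP => _ /mapP[j _ ->].
  by rewrite /root !hornerE pq subrr.
by rewrite size_map size_iota ltnNge leqnSn.
Qed.

Variable N : nat.

Definition freq_part (O : operator R N) (w : nat) : operator R N :=
  \sum_a \sum_(b | weight b == (weight a + w)%N) xproj R a *m O *m xproj R b.

Lemma xproj_adj a : (xproj R a : operator R N) ^t* = xproj R a.
Proof.
rewrite tens_adj; apply: eq_tens => j.
rewrite /xproj1 adjZ adjD adjZ pauli_herm trmx1 map_mx1 rmorphXn rmorphN1.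
by rewrite fmorphV rmorph_nat.
Qed.

Lemma output_expand (rho0 M WL WR : operator R N) x :
  output rho0 M WL WR x =
  \sum_a \sum_b expi (x * ((weight b)%:R - (weight a)%:R)) *
    \tr (WR *m rho0 *m WR ^t* *m (xproj R a *m observable M WL *m xproj R b)).
Proof.
have -> : output rho0 M WL WR x = \tr (WR *m rho0 *m WR ^t* *m
    ((encoder N x) ^t* *m observable M WL *m encoder N x)).
  exact: trace_sandwich.
rewrite encoderE adj_sum !mulmx_suml !mulmx_sumr tr_sum; apply: eq_bigr => a _.
rewrite !mulmx_sumr tr_sum; apply: eq_bigr => b _.
rewrite adjZ xproj_adj -!scalemxAl -!scalemxAr -?scalemxAl !mxtraceZ expi_conj mulrA -expiD.
congr (expi _ * _); ring.
Qed.

(** The given expansion and [output_expand], multiplied by [expi x ^+ N], are polynomials in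
    [expi x]; comparing coefficients shows that [c] is determined by the output. *)
Lemma fourier_coefficient (rho0 M WL WR : operator R N) c w : (w <= N)%N ->
  fourier_expansion N (output rho0 M WL WR) c ->
  c w%:Z = \tr (WR *m rho0 *m WR ^t* *m freq_part (observable M WL) w).
Proof.
move=> wN hc.
pose tau a b := \tr (WR *m rho0 *m WR ^t* *m (xproj R a *m observable M WL *m xproj R b)).
pose P := \poly_(k < N.*2.+1) c (k%:Z - N%:Z).
(* The subtraction in the exponent is never truncated, since [weight a <= N]. *)
pose Q := \sum_a \sum_b tau a b *: 'X^(N + weight b - weight a).
have PQ : P = Q.
  apply: eq_poly_expi => x; transitivity (expi x ^+ N * output rho0 M WL WR x).
    rewrite hc horner_poly mulr_sumr; apply: eq_bigr => k _.
    rewrite mulrCA; congr (_ * _); rewrite !expiX -expiD; congr expi.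
    by rewrite intrB; ring.
  rewrite output_expand mulr_sumr horner_sum; apply: eq_bigr => a _.
  rewrite mulr_sumr horner_sum; apply: eq_bigr => b _.
  rewrite hornerZ hornerXn mulrA mulrC; congr (_ * _).
  rewrite !expiX -expiD; congr expi.
  rewrite natrB ?natrD; first by ring.
  by apply: leq_trans (weight_le a) _; exact: leq_addr.
have : P`_(N + w) = Q`_(N + w) by rewrite PQ.
rewrite coef_poly ltnS -addnn leq_add2l wN PoszD addrAC subrr add0r => ->.
rewrite coef_sum mulmx_sumr tr_sum; apply: eq_bigr => a _.
rewrite coef_sum mulmx_sumr tr_sum [RHS]big_mkcond; apply: eq_bigr => b _.
rewrite coefZ coefXn /tau.
have -> : (N + w == N + weight b - weight a)%N = (weight b == weight a + w)%N.
  have := weight_le a; move: (weight a) (weight b) => m n mN.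
  rewrite -(eqn_add2r m) subnK; last by apply: leq_trans mN _; exact: leq_addr.
  by rewrite -addnA eqn_add2l eq_sym addnC.
by case: eqP => _; rewrite ?mulr1 ?mulr0.
Qed.

(** An eigenvector of the commutator with the generator, written without subtraction; under products
    the eigenvalues add. *)
Definition ad_eigen (A : operator R N) (m : R[i]) : Prop :=
  generator R N *m A = A *m generator R N + m *: A.

Lemma ad_eigenM A B m n : ad_eigen A m -> ad_eigen B n -> ad_eigen (A *m B) (m + n).
Proof.
move=> hA hB; rewrite /ad_eigen mulmxA hA mulmxDl -mulmxA hB mulmxDr mulmxA.
by rewrite -scalemxAr -scalemxAl -addrA -scalerDl addrC [n + m]addrC addrC.
Qed.

Lemma ad_eigen_prod (S : {set 'I_N}) (A : 'I_N -> operator R N) m :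
  (forall j, ad_eigen (A j) m) -> ad_eigen (\prod_(j in S) A j) (m * #|S|%:R).
Proof.
move=> hA; rewrite mulr_natr -sumr_const.
apply: (big_rec2 (fun B n => ad_eigen B n)) => [|j B n _ hB].
  by rewrite /ad_eigen scale0r addr0; exact: etrans (mulmx1 _) (esym (mul1mx _)).
exact: ad_eigenM.
Qed.

(** Only the summand of the generator at site [j] can fail to commute with an operator on site
    [j]. *)
Lemma ad_eigen_local (A : 'M[R[i]]_2) j m :
  pauli_mx R PauliX *m A = A *m pauli_mx R PauliX + m *: A ->
  ad_eigen (local A j) m.
Proof.
move=> hA; rewrite /ad_eigen /generator mulmx_suml mulmx_sumr (bigD1 j) //=.
rewrite [in RHS](bigD1 j) //= -[local_op _ _ j]/(local _ j) !localM hA localD localZ.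
rewrite addrAC; congr (_ + _ + _); apply: eq_bigr => k kj.
exact: local_comm.
Qed.

Lemma ladder_plusE j : ladder_plus R j = local (mx2 1 1 (- 1) (- 1)) j :> operator R N.
Proof.
rewrite /ladder_plus -!/(local _ j) -localZ -localD; congr local.
by rewrite /= !mx2E ?mulrN mulii opprK !(mulr0, add0r, addr0).
Qed.

Lemma ladder_minusE j : ladder_minus R j = local (mx2 1 (- 1) 1 (- 1)) j :> operator R N.
Proof.
rewrite /ladder_minus -!/(local _ j) -scaleNr -localZ -localD; congr local.
by rewrite /= !mx2E ?mulrN ?mulNr mulii ?opprK !(mulr0, add0r, addr0) ?oppr0 ?addr0.
Qed.

(** Under the commutator with the generator each [ladder_plus] has eigenvalue -2, each
    [ladder_minus] has 2 and X has 0; the sum is -2 times the frequency of the plane. *)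
Lemma ad_eigen_plane (r : plane_index N) w : plane_at w r ->
  ad_eigen (plane_E R r) (- (2 * w%:R)).
Proof.
case/and4P => _ _ _ /eqP rw.
have -> : - (2 * w%:R) = (- 2) * #|Splus r|%:R + 2 * #|Sminus r|%:R + 0 * #|Sx r|%:R :> R[i].
  have -> : w%:R = #|Splus r|%:R - #|Sminus r|%:R :> R[i].
    by rewrite -[w%:R]/((w%:Z)%:~R) -rw intrB.
  by ring.
apply: ad_eigenM; first apply: ad_eigenM; apply: ad_eigen_prod => j.
- rewrite ladder_plusE; apply: ad_eigen_local; rewrite /= !mx2E.
  by congr mx2; ring.
- rewrite ladder_minusE; apply: ad_eigen_local; rewrite /= !mx2E.
  by congr mx2; ring.
- by apply: ad_eigen_local; rewrite scale0r addr0.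
Qed.

(** A generator placed before [plane_E] can act on the left projection or be commuted through to the
    right one. The two scalars differ unless [weight b] is [weight a + w]. *)
Lemma plane_E_weight (r : plane_index N) w a b : plane_at w r ->
  weight b != (weight a + w)%N -> xproj R b *m plane_E R r *m xproj R a = 0.
Proof.
move=> /ad_eigen_plane hE ab; apply/eqP; set T := _ *m _.
have h1 : xproj R b *m (generator R N *m plane_E R r) *m xproj R a =
    (N%:R - (weight b)%:R *+ 2) *: T.
  by rewrite mulmxA xproj_generator -!scalemxAl.
have h2 : xproj R b *m (generator R N *m plane_E R r) *m xproj R a =
    (N%:R - (weight a)%:R *+ 2) *: T - (2 * w%:R) *: T.
  rewrite hE mulmxDr mulmxDl scaleNr mulmxN mulNmx; congr (_ - _).
    by rewrite mulmxA -mulmxA generator_xproj -scalemxAr.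
  by rewrite -scalemxAr -scalemxAl.
move/eqP: h1; rewrite h2 -scalerBl -subr_eq0 -scalerBl scaler_eq0 => /orP[|//].
rewrite (_ : _ - _ = 2 * ((weight b)%:R - ((weight a)%:R + w%:R))); last by ring.
rewrite mulf_eq0 pnatr_eq0 /= subr_eq0 -natrD eqr_nat.
by rewrite (negbTE ab).
Qed.

(** Resolutions of the identity on both sides of [O] cut the trace into blocks. By cyclicity the
    block [(a, b)] meets [plane_E] compressed between [xproj b] and [xproj a], which
    [plane_E_weight] kills outside [freq_part]. *)
Lemma tr_freq_part (O : operator R N) (r : plane_index N) w : plane_at w r ->
  \tr (O *m plane_E R r) = \tr (freq_part O w *m plane_E R r).
Proof.
move=> rw; have {1}-> : O = 1%:M *m O *m 1%:M by rewrite mul1mx mulmx1.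
rewrite -(sum_xproj R N).
rewrite !mulmx_suml !tr_sum; apply: eq_bigr => a _.
rewrite mulmx_sumr !mulmx_suml !tr_sum [RHS]big_mkcond; apply: eq_bigr => b _.
case: ifPn => // /(plane_E_weight rw); move: (plane_E R r) => E E0.
rewrite -!mulmxA mxtrace_mulC -!mulmxA.
by rewrite (mulmxA (xproj R b)) E0 mulmx0 mxtrace0.
Qed.

(** For Hermitian [O] the traces against [plane_E] and its adjoint are conjugate, so if the first
    vanished both entries of [bvec] would. *)
Lemma bvec_trace (O : operator R N) (r : plane_index N) : O ^t* = O ->
  bvec O r <> 0 -> \tr (O *m plane_E R r) <> 0.
Proof.
move=> hO hb h; apply: hb.
have h' : \tr (O *m (plane_E R r) ^t*) = 0.
  by rewrite -{1}hO -adjM tr_adj mxtrace_mulC h rmorph0.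
rewrite /bvec /inner_op /plane_X /plane_Y hO mulmxDr -scalemxAr mulmxBr.
by rewrite mxtraceZ !raddfD raddfN /= h h' subr0 addr0 !mulr0.
Qed.

(** Up to nonzero factors the entries of [bvec] are the sum and the difference of the traces against
    [plane_E] and its adjoint; if both vanish, so does each trace. *)
Lemma trace_bvec (O : operator R N) (r : plane_index N) :
  \tr (O ^t* *m plane_E R r) <> 0 -> bvec O r <> 0.
Proof.
move=> h [] h1 h2; apply: h.
have n0 : (2 ^+ N)^-1 != 0 :> R[i] by rewrite invr_eq0 expf_neq0 // pnatr_eq0.
have i0 : 'i^-1 != 0 :> R[i].
  by rewrite invr_eq0; apply/eqP => /(congr1 (@complex.Im R)) /= /eqP; rewrite oner_eq0.
move/eqP: h1; rewrite mulf_eq0 (negbTE n0) /= mulmxDr raddfD /= => /eqP h1.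
move/eqP: h2; rewrite mulf_eq0 (negbTE n0) /= -scalemxAr mxtraceZ mulf_eq0 (negbTE i0) /=.
rewrite mulmxBr raddfB /= => /eqP h2.
have h2' : \tr (O ^t* *m plane_E R r) = \tr (O ^t* *m (plane_E R r) ^t*).
  by apply/eqP; rewrite -subr_eq0 h2.
by move/eqP: h1; rewrite -h2' -mulr2n mulrn_eq0 /= => /eqP.
Qed.

End Fourier.

(** * Closed forms of the rotation gates *)

Section Rotations.
Variable R : realType.

Lemma expi_cos_sin (x : R) : expi x = (cos x)%:C + 'i * (sin x)%:C.
Proof. by apply/eqP; rewrite eq_complex /= !(mul0r, mul1r, subr0, addr0, add0r) !eqxx. Qed.

Lemma half_double (V : lmodType R[i]) (v : V) : 2^-1 *: (v + v) = v.
Proof. by rewrite scalerDr -scalerDl -[2^-1]mul1r -splitr scale1r. Qed.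

(** An involution [P] has the eigenprojections [(1 + P) / 2] and [(1 - P) / 2], to which
    [expm_eigen] applies. *)
Lemma rotationE d (P : 'M[R[i]]_d) t : P *m P = 1%:M ->
  rotation P t = (cos (t / 2))%:C *: 1%:M - ('i * (sin (t / 2))%:C) *: P.
Proof.
move=> PP; set x := t / 2; set c := - ('i * x%:C).
have ec : - ('i * t%:C / 2) = c.
  by rewrite /c /x rmorphM fmorphV rmorph_nat mulrA.
have ed : - ('i * (- x)%:C) = - c by rewrite /c rmorphN mulrN.
rewrite /rotation ec (@expm_eigen R bool d _ (fun b => if b then x else - x)
  (fun b => if b then 2^-1 *: (1%:M + P) else 2^-1 *: (1%:M - P))); first last.
- case; rewrite ?ed -scalemxAl -!scalemxAr ?mulmxDr ?mulmxN mulmx1 PP.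
    by rewrite [P + _]addrC.
  by rewrite [RHS]scaleNr -!scalerN opprB.
- by rewrite big_bool /= -scalerDr addrACA subrr addr0 half_double.
rewrite big_bool opprK !expi_cos_sin cosN sinN rmorphN mulrN.
move: (_%:C) ('i * _) => C S; apply/matrixP => i j; rewrite !mxE.
have h : 2^-1 * 2 = 1 :> R[i] by rewrite mulVf // pnatr_eq0.
move: (i == j)%:R (P i j) => x' y; transitivity (2^-1 * 2 * (C * x' - S * y)).
  by ring.
by rewrite h mul1r.
Qed.

Lemma cos_sin_sqr (x : R) : (cos x)%:C * (cos x)%:C + (sin x)%:C * (sin x)%:C = 1 :> R[i].
Proof. by rewrite -!rmorphM -rmorphD -!expr2 cos2Dsin2. Qed.

Lemma rotationN d (P : 'M[R[i]]_d) t : P *m P = 1%:M ->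
  rotation P t *m rotation P (- t) = 1%:M.
Proof.
move=> PP; rewrite !rotationE // mulNr cosN sinN rmorphN mulrN scaleNr opprK.
rewrite mulmxBl !mulmxDr -!scalemxAl -!scalemxAr !mul1mx mulmx1 PP !scalerA.
rewrite [X in _ - (X + _)](_ : _ = ((cos (t / 2))%:C * ('i * (sin (t / 2))%:C)) *: P).
  rewrite opprD addrA addrK -scaleNr -scalerDl.
  rewrite mulrACA mulii mulN1r opprK cos_sin_sqr scale1r.
  by [].
by rewrite mulrC.
Qed.

Lemma rotationZ t : rotation (pauli_mx R PauliZ) t = mx2 (expi (- (t / 2))) 0 0 (expi (t / 2)).
Proof.
rewrite rotationE ?pauli_sqr //= mx2_scalar !mx2E !expi_cos_sin cosN sinN rmorphN.
by congr mx2; ring.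
Qed.

Lemma rotationY t : rotation (pauli_mx R PauliY) t =
  mx2 (cos (t / 2))%:C (- (sin (t / 2))%:C) (sin (t / 2))%:C (cos (t / 2))%:C.
Proof.
rewrite rotationE ?pauli_sqr //= complexiE mx2_scalar !mx2E.
move: (mulii R); move: ('i%R : R[i]) => i ii.
move: (cos _)%:C (sin _)%:C => c s.
by congr mx2; ring: ii.
Qed.

End Rotations.

(** * Single-qubit pure states and Euler rotations *)

Section Bloch.
Variable R : realType.

(** The pure qubit state with azimuth [a] and polar angle [s] on the Bloch sphere. *)
Definition bloch (a s : R) : 'M[R[i]]_2 :=
  2^-1 *: mx2 (1 + (cos s)%:C) (expi (- a) * (sin s)%:C)
              (expi a * (sin s)%:C) (1 - (cos s)%:C).

Lemma unit_circle (x y : R) : x ^+ 2 + y ^+ 2 = 1 -> exists t, cos t = x /\ sin t = y.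
Proof.
move=> xy.
have xI : -1 <= x <= 1.
  by rewrite -ler_norml -(@ler_pXn2r _ 2) ?nnegrE // expr1n real_normK ?num_real //
    -xy lerDl sqr_ge0.
have sx : sin (acos x) = `|y|.
  by rewrite sin_acos // -xy addrAC subrr add0r sqrtr_sqr.
have [y0|y0] := leP 0 y.
  by exists (acos x); rewrite acosK ?in_itv //= sx ger0_norm.
by exists (- acos x); rewrite cosN sinN acosK ?in_itv //= sx ltr0_norm ?opprK.
Qed.

Lemma polar (z : R[i]) : exists (r t : R), z = r%:C * expi t.
Proof.
case: z => x y; set r := Num.sqrt (x ^+ 2 + y ^+ 2).
have r2 : r ^+ 2 = x ^+ 2 + y ^+ 2 by rewrite sqr_sqrtr // addr_ge0 ?sqr_ge0.
have [r0|r0] := eqVneq r 0.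
  exists 0, 0; rewrite mul0r; apply/eqP; rewrite eq_complex /=.
  move/eqP: r2; rewrite r0 expr0n eq_sym paddr_eq0 ?sqr_ge0 //.
  by rewrite !sqrf_eq0.
have [|t [ct st]] := @unit_circle (x / r) (y / r).
  by rewrite !expr_div_n -mulrDl -r2 divff // expf_neq0.
exists r, t; apply/eqP; rewrite eq_complex /= ct st !mul0r subr0 addr0.
by rewrite ![r * _]mulrC !divfK ?eqxx.
Qed.

Lemma conjRC (x : R) : Num.conj x%:C = x%:C :> R[i].
Proof. by apply/eqP; rewrite eq_complex /= oppr0 !eqxx. Qed.

Lemma conjNRC (x : R) : Num.conj (- x%:C) = - x%:C :> R[i].
Proof. by rewrite rmorphN; congr (- _); exact: conjRC. Qed.

Lemma conj_polar (r t : R) : Num.conj (r%:C * expi t) = r%:C * expi (- t).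
Proof. by rewrite rmorphM; congr (_ * _); [exact: conjRC|exact: expi_conj]. Qed.

Lemma cosDC (x y : R) :
  (cos (x + y))%:C = (cos x)%:C * (cos y)%:C - (sin x)%:C * (sin y)%:C :> R[i].
Proof. by rewrite cosD rmorphB !rmorphM. Qed.

Lemma sinDC (x y : R) :
  (sin (x + y))%:C = (sin x)%:C * (cos y)%:C + (cos x)%:C * (sin y)%:C :> R[i].
Proof. by rewrite sinD rmorphD !rmorphM. Qed.

Lemma half2 : 2^-1 * 2 = 1 :> R[i].
Proof. by rewrite mulVf // pnatr_eq0. Qed.

Lemma halfD (x : R[i]) : 2^-1 * (x + x) = x.
Proof. exact: (half_double (V := R[i]^o)). Qed.

(** Up to phases [v] has coordinates [cos t] and [sin t]; the relative phase is the azimuth and the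
    doubled angle [t + t] the polar angle. *)
Lemma pure_bloch (v : 'cV[R[i]]_2) : v ^t* *m v = 1%:M ->
  exists a s, v *m v ^t* = bloch a s.
Proof.
move=> hv; have [r [a va]] := polar (v 0 0); have [q [b vb]] := polar (v 1 0).
have : r ^+ 2 + q ^+ 2 = 1.
  have e : (v ^t* *m v) 0 0 = Num.conj (v 0 0) * v 0 0 + Num.conj (v 1 0) * v 1 0.
    rewrite mxE big_ord_recl big_ord1 !mxE; congr (_ + Num.conj (v _ _) * v _ _);
    exact/val_inj.
  have := congr1 (@complex.Re R) e; rewrite hv mxE /=.
  rewrite va vb !conj_polar.
  rewrite mulrACA expiNK mulr1 [X in _ + X]mulrACA expiNK mulr1 -!rmorphM -rmorphD /=.
  by rewrite -!expr2.
case/unit_circle => t [ct st]; exists (b - a), (t + t).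
rewrite [LHS]mx2_eta !mxE !big_ord1 !mxE /bloch cosDC sinDC va vb -ct -st.
rewrite !conj_polar opprB !expiD.
have ea := expiNK a; have eb := expiNK b; have cs := cos_sin_sqr t.
rewrite mx2Z; move: ea eb cs.
move: (cos t)%:C (sin t)%:C (expi a) (expi b) (expi (- a)) (expi (- b)).
move=> c s A B A' B' eA eB cs.
have {}cs : c * c = 1 - s * s by rewrite -cs addrK.
congr mx2.
- by rewrite (_ : 1 + _ = c * c + c * c) ?halfD; ring: cs eA.
- by rewrite (_ : _ * (_ + _) = A * B' * (c * s) + A * B' * (c * s)) ?halfD; ring.
- by rewrite (_ : _ * (_ + _) = B * A' * (c * s) + B * A' * (c * s)) ?halfD; ring.
- by rewrite (_ : 1 - _ = s * s + s * s) ?halfD; ring: cs eB.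
Qed.

Lemma rotationZ_bloch d a s : let U := rotation (pauli_mx R PauliZ) d in
  U *m bloch a s *m U ^t* = bloch (a + d) s.
Proof.
rewrite /= rotationZ /bloch -scalemxAr -scalemxAl; congr (_ *: _).
rewrite !mx2E !expi_conj rmorph0 opprK opprD !expiD.
have -> : expi (- d) = expi (- (d / 2)) * expi (- (d / 2)).
  by rewrite -expiD -opprD -splitr.
have -> : expi d = expi (d / 2) * expi (d / 2) by rewrite -expiD -splitr.
have e := expiNK (d / 2); move: e.
move: (expi (d / 2)) (expi (- (d / 2))) => D D' e; congr mx2; ring: e.
Qed.

(** At azimuth 0 the Bloch vector lies in the plane that a Y rotation maps to itself, so the polar
    angles add. *)
Lemma rotationY_bloch b s : let U := rotation (pauli_mx R PauliY) b in
  U *m bloch 0 s *m U ^t* = bloch 0 (s + b).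
Proof.
rewrite /= rotationY /bloch -scalemxAr -scalemxAl; congr (_ *: _).
rewrite !mx2E !conjNRC !conjRC oppr0 expi0 !mul1r.
have cb := cosDC (b / 2) (b / 2); have sb := sinDC (b / 2) (b / 2).
rewrite -splitr in cb sb; rewrite cosDC sinDC cb sb.
have := cos_sin_sqr (b / 2).
move: (cos (b / 2))%:C (sin (b / 2))%:C (cos s)%:C (sin s)%:C => c t x y e.
have {}e : c * c = 1 - t * t by rewrite -e addrK.
by congr mx2; ring: e.
Qed.

Definition euler (a b d : R) := rotation (pauli_mx R PauliZ) a *m
  rotation (pauli_mx R PauliY) b *m rotation (pauli_mx R PauliZ) d.

(** The rotation acting first brings the azimuth to 0, the Y rotation adjusts the polar angle, and
    the last Z rotation sets the azimuth, so its angle is the target [a] itself. *)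
Lemma euler_pure (v : 'cV[R[i]]_2) a s : v ^t* *m v = 1%:M ->
  exists b d, euler a b d *m (v *m v ^t*) *m (euler a b d) ^t* = bloch a s.
Proof.
case/pure_bloch => [a0 [s0 ->]]; exists (s - s0), (- a0).
rewrite /euler !adjM !mulmxA.
have := rotationZ_bloch (- a0) a0 s0; rewrite /= subrr => h3.
have := rotationY_bloch (s - s0) s0; rewrite /= [s0 + _]addrC subrK => h2.
have := rotationZ_bloch a 0 s; rewrite /= add0r => h1.
rewrite -h1 -h2 -h3.
move: (rotation _ a) (rotation _ (s - s0)) (rotation _ (- a0)) (bloch _ _) => A B C D.
by rewrite !mulmxA.
Qed.

(* The pure states |0>, |1>, |+> and |+i>. *)
Definition probe_angles (k : 'I_4) : R * R :=
  nth (0, 0) [:: (0, 0); (0, pi); (0, pi / 2); (pi / 2, pi / 2)] k.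

Lemma bloch_span (A : 'M[R[i]]_2) : exists x : 'I_4 -> R[i],
  A = \sum_k x k *: bloch (probe_angles k).1 (probe_angles k).2.
Proof.
set p := A 0 0; set q := A 0 1; set r := A 1 0; set t := A 1 1.
(* The off-diagonal entries dictate the coefficients [q + r] and ['i * (q - r)] of the last two
   states; [u] is what those two add to each diagonal entry, compensated in the first two
   coefficients. *)
pose u := 2^-1 * ((1 + 'i) * q + (1 - 'i) * r).
exists (fun k => nth 0 [:: p - u; t - u; q + r; 'i * (q - r)] k).
rewrite [LHS]mx2_eta -/p -/q -/r -/t !big_ord_recl big_ord0 addr0 /probe_angles /= /bloch /=.
rewrite oppr0 expi0 cos0 sin0 cospi sinpi cos_pihalf sin_pihalf.
have -> : expi (pi / 2 : R) = 'i%R by rewrite /expi cos_pihalf sin_pihalf.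
have -> : expi (- (pi / 2) : R) = - 'i.
  by rewrite expi_cos_sin cosN sinN cos_pihalf sin_pihalf rmorphN rmorph1 rmorph0 mulrN mulr1 add0r.
rewrite !rmorphN !rmorph1 !rmorph0 !mx2Z !mx2D !opprK !subrr !addr0 !subr0.
have h : 2^-1 * (1 + 1) = 1 :> R[i] by exact: half2.
rewrite !h /u; move: (mulii R).
move: ('i%R : R[i]) => i ii; congr mx2.
- by ring: ii.
- by transitivity (2^-1 * (1 + 1) * q); [rewrite h mul1r|ring: ii].
- by transitivity (2^-1 * (1 + 1) * r); [rewrite h mul1r|ring: ii].
- by ring: ii.
Qed.

End Bloch.

(** * Matrices with trigonometric polynomial entries *)

Section TrigMatrix.
Variables (R : realType) (p : nat).

Definition trigmx m n (A : 'rV[R]_p -> 'M[R[i]]_(m, n)) :=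
  forall a b, trigpoly (@row_coord R p) (fun t => A t a b).

Lemma trigmx_cst m n (A : 'M[R[i]]_(m, n)) : trigmx (fun=> A).
Proof. by move=> a b; exact: trigpoly_cst. Qed.

Lemma trigmxM m n k (A : 'rV[R]_p -> 'M[R[i]]_(m, n)) (B : 'rV[R]_p -> 'M[R[i]]_(n, k)) :
  trigmx A -> trigmx B -> trigmx (fun t => A t *m B t).
Proof.
move=> hA hB a b.
apply: (@eq_trigpoly _ _ _ (fun t => \sum_c A t a c * B t c b)) => [t|].
  by rewrite mxE.
by apply: trigpoly_sum => c _; apply: trigpolyM; [exact: hA|exact: hB].
Qed.

Lemma trigmx_sum m n (I : finType) (P : pred I) (A : I -> 'rV[R]_p -> 'M[R[i]]_(m, n)) :
  (forall i, trigmx (A i)) -> trigmx (fun t => \sum_(i | P i) A i t).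
Proof.
move=> hA a b.
apply: (@eq_trigpoly _ _ _ (fun t => \sum_(i | P i) A i t a b)) => [t|].
  by rewrite summxE.
by apply: trigpoly_sum => c _; exact: hA.
Qed.

Lemma trigmx_adj m n (A : 'rV[R]_p -> 'M[R[i]]_(m, n)) :
  trigmx A -> trigmx (fun t => (A t) ^t*).
Proof.
move=> hA a b; apply: eq_trigpoly (trigpoly_conj (hA b a)) => t.
by rewrite !mxE.
Qed.

Lemma trigmx_tr n (A : 'rV[R]_p -> 'M[R[i]]_n) :
  trigmx A -> trigpoly (@row_coord R p) (fun t => \tr (A t)).
Proof. by move=> hA; apply: trigpoly_sum => c _; exact: hA. Qed.

(** The eigenprojections of [P] carry the phases [expi] of plus and minus half the angle, the two
    generators of [trigpoly]. *)
Lemma trigmx_rotation d (P : 'M[R[i]]_d) (k : 'I_p) : P *m P = 1%:M ->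
  trigmx (fun t => rotation P (t 0 k)).
Proof.
move=> PP a b.
pose z (t : 'rV[R]_p) := expi (t 0 k / 2); pose w (t : 'rV[R]_p) := expi (- (t 0 k / 2)).
apply: (@eq_trigpoly _ _ _ (fun t => z t * (2^-1 * ((1%:M : 'M[R[i]]_d) a b - P a b))
    + w t * (2^-1 * ((1%:M : 'M[R[i]]_d) a b + P a b)))) => [t|].
  rewrite rotationE // [RHS]mxE [X in _ = X + _]mxE [X in _ = _ + X]mxE [X in _ = _ - X]mxE.
  rewrite /z /w !expi_cos_sin cosN sinN rmorphN mulrN.
  move: (cos _)%:C ('i * _) => c s; move: (1%:M a b) (P a b) => x y.
  rewrite -[c * x in RHS]halfD -[s * y in RHS]halfD; ring.
apply: trigpolyD; apply: trigpolyM; try exact: trigpoly_cst.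
  by apply: (@trigpoly_expi _ _ _ (fun t : 'rV[R]_p => t 0 k)); exists k.
by apply: (@trigpoly_expiN _ _ _ (fun t : 'rV[R]_p => t 0 k)); exists k.
Qed.

Lemma trigmx_tens N (A : 'rV[R]_p -> 'I_N -> 'M[R[i]]_2) :
  (forall j, trigmx (fun t => A t j)) -> trigmx (fun t => tens (A t)).
Proof.
move=> hA a b.
apply: (@eq_trigpoly _ _ _ (fun t => \prod_j A t j (ket a j) (ket b j))) => [t|].
  by rewrite mxE.
by apply: trigpoly_prod => j _; exact: hA.
Qed.

End TrigMatrix.

(** * Nonvanishing of coefficients for parameterized circuits *)

Section Circuits.
Variables (R : realType) (N : nat).

Lemma pauli_string_sqr (P : 'I_N -> pauli) :
  pauli_string R P *m pauli_string R P = 1%:M.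
Proof. by rewrite tensM -tens1; apply: eq_tens => j; exact: pauli_sqr. Qed.

Lemma trigmx_circuit p (C : seq (gate R N p)) : trigmx (circuit_op C).
Proof.
rewrite /circuit_op; elim: C => [|g C IH] a b.
  apply: (@eq_trigpoly _ _ _ (fun=> (1 : operator R N) a b)) => [t|].
    by rewrite big_nil.
  exact: trigpoly_cst.
apply: (@eq_trigpoly _ _ _ (fun t => (gate_op t g *m \prod_(h <- C) gate_op t h) a b)) => [t|].
  by rewrite big_cons.
apply: trigmxM => //; case: g => [U hU|P k]; first exact: trigmx_cst.
by apply: trigmx_rotation; exact: pauli_string_sqr.
Qed.

(** Invertibility lets a circuit be moved from the state to the observable without losing
    nonvanishing. *)
Lemma circuit_unit p (C : seq (gate R N p)) t : circuit_op C t \in unitmx.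
Proof.
rewrite /circuit_op; elim: C => [|g C IH]; first by rewrite big_nil unitmx1.
rewrite big_cons unitmx_mul IH andbT; case: g => [U hU|P k] /=.
  exact: unitarymx_unit.
have [h _] := mulmx1_unit (rotationN (t 0 k) (pauli_string_sqr P)).
exact: h.
Qed.

Lemma rotation_layerE (theta : 'rV[R]_(N * 3)) : rotation_layer theta =
  tens (fun j => euler (theta 0 (mxvec_index j 0)) (theta 0 (mxvec_index j 1))
                       (theta 0 (mxvec_index j 2%:R))).
Proof. by []. Qed.

Lemma trigmx_layer : trigmx (@rotation_layer R N).
Proof.
apply: trigmx_tens => j.
by apply: trigmxM; [apply: trigmxM|]; apply: trigmx_rotation; exact: pauli_sqr.
Qed.

Lemma trigmx_lsub p q m n (A : 'rV[R]_p -> 'M[R[i]]_(m, n)) : trigmx A ->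
  trigmx (fun t : 'rV[R]_(p + q) => A (lsubmx t)).
Proof.
move=> hA a b; apply: (trigpoly_comp _ (hA a b)) => _ [k ->].
by left; exists (lshift q k); apply/funext => t /=; rewrite mxE.
Qed.

Lemma trigmx_rsub p q m n (A : 'rV[R]_q -> 'M[R[i]]_(m, n)) : trigmx A ->
  trigmx (fun t : 'rV[R]_(p + q) => A (rsubmx t)).
Proof.
move=> hA a b; apply: (trigpoly_comp _ (hA a b)) => _ [k ->].
by left; exists (rshift p k); apply/funext => t /=; rewrite mxE.
Qed.

Lemma layer_angles (h : 'I_N -> 'I_3 -> R) : exists theta : 'rV[R]_(N * 3),
  forall j k, theta 0 (mxvec_index j k) = h j k.
Proof.
by exists (mxvec (\matrix_(j, k) h j k)) => j k; rewrite mxvecE mxE.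
Qed.

(** Matrix units of the full space are tensor products of one-qubit matrix units, so traces against
    products determine an operator entry by entry. *)
Lemma tr_tens_delta (T : operator R N) a b :
  \tr (tens (fun j => delta_mx (ket a j) (ket b j)) *m T) = T b a.
Proof.
have -> : tens (fun j => delta_mx (ket a j) (ket b j)) = delta_mx a b :> operator R N.
  apply/matrixP => c d; rewrite !mxE.
  under eq_bigr do rewrite mxE.
  have [->|ca] := eqVneq c a.
    have [->|db] := eqVneq d b; first by rewrite big1 // => j _; rewrite !eqxx.
    by have [j /negbTE hj] := ket_neq db; rewrite (bigD1 j) //= hj andbF mul0r.
  by have [j /negbTE hj] := ket_neq ca; rewrite (bigD1 j) //= hj mul0r.
rewrite /mxtrace (bigD1 a) //= big1 ?addr0; last first.
  by move=> c ca; rewrite mxE big1 // => d _; rewrite mxE (negbTE ca) mul0r.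
rewrite mxE (bigD1 b) //= big1 ?addr0; first by rewrite mxE !eqxx mul1r.
by move=> d db; rewrite mxE (negbTE db) andbF mul0r.
Qed.

(** By contraposition: if all these traces vanish, so do the traces of [T] against products of the
    four probe states. These states span the one-qubit matrices, so by multilinearity every entry of
    [T] is 0. *)
Lemma product_states_span (phi : 'I_N -> 'cV[R[i]]_2) (T : operator R N) :
  (forall j, (phi j) ^t* *m phi j = 1%:M) -> T <> 0 ->
  exists theta : 'rV[R]_(N * 3), \tr (rotation_layer theta *m product_state phi *m
    (rotation_layer theta) ^t* *m T) <> 0.
Proof.
move=> hphi T0; apply: contrapT => /forallNP h; apply: T0.
have h1 (f : {ffun 'I_N -> 'I_4}) : \tr (tens (fun j =>
    bloch (probe_angles R (f j)).1 (probe_angles R (f j)).2) *m T) = 0.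
  have /fin_all_exists[b hb] j := euler_pure (probe_angles R (f j)).1
    (probe_angles R (f j)).2 (hphi j).
  have {hb} /fin_all_exists[d hd] := hb.
  (* The outer Z angle is the azimuth of the target state at site [j]; [b j] and [d j] come from
     [euler_pure]. *)
  have [theta ht] := layer_angles (fun j k =>
    if k == 0 then (probe_angles R (f j)).1 else if k == 1 then b j else d j).
  move: (h theta) => /contrapT; rewrite rotation_layerE tens_adj !tensM => <-.
  congr (\tr (_ *m _)); apply: eq_tens => j; rewrite -hd.
  by rewrite !ht.
apply/matrixP => b a; rewrite mxE -tr_tens_delta.
have /fin_all_exists[x hx] j := bloch_span (delta_mx (ket a j) (ket b j) : 'M[R[i]]_2).
rewrite (eq_tens hx) tens_sum mulmx_suml tr_sum big1 // => f _.
by rewrite tensZ -scalemxAl mxtraceZ h1 mulr0.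
Qed.

(** The left block is any family with trigonometric polynomial entries, so that the same argument
    serves a general circuit and the star-shaped block. *)
Lemma coefficient_almost_every pL pV (WL : 'rV[R]_pL -> operator R N)
    (M : operator R N) (phi : 'I_N -> 'cV[R[i]]_2) (V : seq (gate R N pV))
    (c : 'rV[R]_(pL + (N * 3 + pV)) -> int -> R[i]) (w : nat) :
  trigmx WL -> (forall j, (phi j) ^t* *m phi j = 1%:M) ->
  (forall Theta, fourier_expansion N
     (output (product_state phi) M (WL (lsubmx Theta)) (state_block V (rsubmx Theta)))
     (c Theta)) ->
  (w <= N)%N ->
  (exists t r, plane_at w r /\ \tr (observable M (WL t) *m plane_E R r) <> 0) ->
  almost_every (fun Theta => c Theta w%:Z <> 0).
Proof.
move=> hWL hphi hc wN [tL [r [rw hr]]].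
pose F (Theta : 'rV[R]_(pL + (N * 3 + pV))) :=
  \tr (state_block V (rsubmx Theta) *m product_state phi *m
       (state_block V (rsubmx Theta)) ^t* *m
       freq_part (observable M (WL (lsubmx Theta))) w).
have cF Theta : c Theta w%:Z = F Theta by exact: fourier_coefficient.
rewrite (_ : (fun _ => _) = fun Theta => F Theta <> 0); last first.
  by apply/funext => Theta; rewrite cF.
apply: almost_every_trigpoly.
  have tWR : trigmx (fun Theta : 'rV[R]_(pL + (N * 3 + pV)) => state_block V (rsubmx Theta)).
    apply: (@trigmx_rsub _ _ _ _ (state_block V)); apply: trigmxM.
      by apply: trigmx_rsub; exact: trigmx_circuit.
    by apply: trigmx_lsub; exact: trigmx_layer.
  have tWL : trigmx (fun Theta : 'rV[R]_(pL + (N * 3 + pV)) => WL (lsubmx Theta)).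
    exact: trigmx_lsub.
  apply: trigmx_tr; apply: trigmxM.
    apply: trigmxM; last exact: trigmx_adj.
    by apply: trigmxM => //; exact: trigmx_cst.
  apply: trigmx_sum => a; apply: trigmx_sum => b.
  apply: trigmxM; last exact: trigmx_cst.
  apply: trigmxM; first exact: trigmx_cst.
  by apply: trigmxM => //; apply: trigmxM; [exact: trigmx_adj|exact: trigmx_cst].
set A := freq_part (observable M (WL tL)) w.
have A0 : A <> 0.
  move=> A0; apply: hr; rewrite (tr_freq_part _ rw).
  by rewrite -/A A0 mul0mx mxtrace0.
(* The parameters of [V] are frozen at 0, and the resulting invertible operator is moved onto the
   frequency part, which stays nonzero. *)
pose U := circuit_op V 0.
have uU : U \in unitmx by exact: circuit_unit.
have uU' : U ^t* \in unitmx by rewrite map_unitmx unitmx_tr.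
have T0 : U ^t* *m A *m U <> 0.
  move=> h; apply: A0; rewrite -(mulKmx uU' A) -(mulmxK uU (U ^t* *m A)) h.
  by rewrite mul0mx mulmx0.
have [theta ht] := product_states_span hphi T0.
exists (row_mx tL (row_mx theta 0)).
rewrite /F row_mxKl row_mxKr /state_block row_mxKl row_mxKr -/A -/U.
move=> h; apply: ht; rewrite -[RHS]h.
move: (rotation_layer theta) (product_state phi) => W s.
by rewrite adjM !mulmxA [LHS]mxtrace_mulC !mulmxA.
Qed.

End Circuits.

(** * The quarter turn about the Y axis *)

Section QuarterTurn.
Variable R : realType.

Definition turn : 'M[R[i]]_2 := rotation (pauli_mx R PauliY) (pi / 2).

(** The entry is the common value of cosine and sine at [pi / 4]; keeping it abstract leaves later
    products to [ring]. *)
Lemma turnE : exists c : R[i], [/\ Num.conj c = c, Num.conj (- c) = - c, c * c + c * c = 1 &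
  turn = mx2 c (- c) c c].
Proof.
exists (cos (pi / 2 / 2))%:C; rewrite conjRC conjNRC.
have e : sin (pi / 2 / 2) = cos (pi / 2 / 2) :> R.
  rewrite -[in RHS]cosN -sinDpihalf; congr sin.
  by apply/eqP; rewrite eq_sym addrC subr_eq -splitr.
by split=> //; [rewrite -{3 4}e cos_sin_sqr|rewrite /turn rotationY e].
Qed.

(** Conjugation by the turn carries Z + iY to 2 |0><1|, and the trace reads off the entry in row 1,
    column 0. *)
Lemma turn_plus (x y z t : R[i]) :
  \tr (turn ^t* *m mx2 x y z t *m turn *m mx2 1 1 (- 1) (- 1)) = 2 * z.
Proof.
have [c [cc ncc c1 ->]] := turnE; rewrite !mx2E mx2_tr cc ncc.
by transitivity ((c * c + c * c) * (2 * z)); [ring|rewrite c1 mul1r].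
Qed.

(** The same conjugation carries X to -Z. *)
Lemma turn_X (x y z t : R[i]) :
  \tr (turn ^t* *m mx2 x y z t *m turn *m pauli_mx R PauliX) = t - x.
Proof.
have [c [cc ncc c1 ->]] := turnE; rewrite /= !mx2E mx2_tr cc ncc.
by transitivity ((c * c + c * c) * (t - x)); [ring|rewrite c1 mul1r].
Qed.

Lemma turn_Z : turn ^t* *m pauli_mx R PauliZ *m turn = - pauli_mx R PauliX.
Proof.
have [c [cc ncc c1 ->]] := turnE.
transitivity (- mx2 0 (c * c + c * c) (c * c + c * c) 0); last by rewrite c1.
by rewrite /= !mx2E cc ncc; congr mx2; ring.
Qed.

Lemma euler0 (b : bool) : euler 0 (if b then pi / 2 else 0) 0 =
  if b then turn else 1%:M.
Proof.
have Z0 : rotation (pauli_mx R PauliZ) 0 = 1%:M.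
  by rewrite rotationZ mul0r oppr0 expi0 mx2_scalar.
rewrite /euler Z0 mulmx1 mul1mx; case: b; first by [].
by rewrite rotationY mul0r cos0 sin0 mx2_scalar rmorph0 rmorph1 oppr0.
Qed.

End QuarterTurn.

(** * Conjugation by the entangler *)

Section Star.
Variables (R : realType) (N : nat) (n : 'I_N) (e : rel 'I_N).
Variable gamma : 'I_N -> 'I_N -> R.
Hypothesis he : irreflexive e.

Definition sgn2 (k : 'I_2) : R := (-1) ^+ k.

(** The eigenvalue on the basis ket [a] of the sum of the [gamma n k] Z_n Z_k in the exponent of the
    entangler. *)
Definition phase (a : 'I_(hdim N)) : R :=
  \sum_(k in neighbours e n) gamma n k * (sgn2 (ket a n) * sgn2 (ket a k)).

Lemma localZ_entry j (a b : 'I_(hdim N)) : local (pauli_mx R PauliZ) j a b =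
  if a == b then (sgn2 (ket a j))%:C else 0.
Proof.
rewrite localE; have [->|ab] := eqVneq a b.
  rewrite big1 ?mulr1 => [|i _]; last by rewrite eqxx.
  rewrite mxE /sgn2; case: (ket b j) => -[|[|]] //= _.
  by rewrite expr1 rmorphN1.
have [i hi] := ket_neq ab; have [ij|ij] := eqVneq i j.
  rewrite mxE -ij; move: hi; case: (ket a i) => -[|[|]] //= ?;
  by case: (ket b i) => -[|[|]] //= ?; rewrite mul0r.
by rewrite (bigD1 i) //= (negbTE hi) mul0r mulr0.
Qed.

Lemma entangler_entry a b : entangler e gamma n a b =
  if a == b then expi (- (phase a / 2)) else 0.
Proof.
pose D (c : 'I_(hdim N)) : operator R N := delta_mx c c.
have sD : \sum_c D c = 1%:M.
  apply/matrixP => i j; rewrite summxE (bigD1 i) //= big1 ?addr0 => [|c ci].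
    by rewrite !mxE eqxx eq_sym.
  by rewrite mxE eq_sym (negbTE ci).
have hZ j c : local (pauli_mx R PauliZ) j *m D c = (sgn2 (ket c j))%:C *: D c.
  apply/matrixP => i k; rewrite !mxE (bigD1 i) //= big1 ?addr0 => [|l li].
    rewrite localZ_entry eqxx mxE; case: eqP => [->|] //=.
    by rewrite !mulr0.
  by rewrite localZ_entry eq_sym (negbTE li) mul0r.
rewrite /entangler (@expm_eigen _ _ _ _ (fun a => phase a / 2) D) //.
  rewrite summxE (bigD1 a) //= big1 ?addr0 => [|c ca].
    by rewrite !mxE eqxx /= [b == a]eq_sym; case: eqP; rewrite ?mulr1 ?mulr0.
  by rewrite !mxE [a == c]eq_sym (negbTE ca) mulr0.
move=> c; rewrite -scalemxAl mulmx_suml.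
have -> : \sum_(k in neighbours e n) (gamma n k)%:C *:
    (local_op R PauliZ n *m local_op R PauliZ k) *m D c = (phase c)%:C *: D c.
  rewrite /phase rmorph_sum scaler_suml; apply: eq_bigr => k _.
  rewrite -scalemxAl -mulmxA [X in _ *m X]hZ -scalemxAr hZ !scalerA.
  by rewrite !rmorphM; congr (_ *: _); ring.
by rewrite scalerA; congr (_ *: _); rewrite fmorph_div rmorph_nat; ring.
Qed.

Lemma entangler_adj_entry a b : (entangler e gamma n) ^t* a b =
  if a == b then expi (phase a / 2) else 0.
Proof.
rewrite 2!mxE entangler_entry eq_sym; case: eqP => [->|_]; last exact: rmorph0.
by rewrite expi_conj opprK.
Qed.

(** For [t = 0] these are the factors of |0><1| at qubit [n] times exp(i gamma Z) on the neighbours;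
    for [t = 1], of |1><0| with the inverse phases. *)
Definition star_factor (t : 'I_2) (j : 'I_N) : 'M[R[i]]_2 :=
  if j == n then delta_mx t (1 - t)
  else if j \in neighbours e n then
    mx2 (expi (sgn2 t * gamma n j)) 0 0 (expi (- (sgn2 t * gamma n j)))
  else 1%:M.

Lemma sgn2_flip t : sgn2 (1 - t) = - sgn2 t.
Proof. by case: t => -[|[|]] // ?; rewrite /sgn2 /= ?expr0 ?expr1 ?opprK. Qed.

(** An entry survives only between basis kets that differ exactly at qubit [n]; there [phase]
    changes sign, and the two half phases add up to a full one that factors over the neighbours. *)
Lemma entangler_local t : (entangler e gamma n) ^t* *m
  local (delta_mx t (1 - t)) n *m entangler e gamma n = tens (star_factor t).
Proof.
apply/matrixP => a b; rewrite mxE (bigD1 b) //= big1 ?addr0 => [|c cb]; last first.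
  by rewrite entangler_entry (negbTE cb) mulr0.
rewrite mxE (bigD1 a) //= big1 ?addr0 => [|c ca]; last first.
  by rewrite entangler_adj_entry eq_sym (negbTE ca) mul0r.
rewrite entangler_adj_entry entangler_entry !eqxx [RHS]mxE.
rewrite [in RHS](bigD1 n) //= localE {1}/star_factor [in RHS]eqxx mxE.
have [an|an] := eqVneq (ket a n) t; last by rewrite !mul0r mulr0 mul0r.
have [bn|bn] := eqVneq (ket b n) (1 - t); last by rewrite !mul0r mulr0 mul0r.
rewrite !mul1r.
have [/forallP ab|] := boolP [forall j, (j != n) ==> (ket a j == ket b j)]; last first.
  rewrite negb_forall => /existsP[j]; rewrite negb_imply => /andP[jn hj].
  rewrite (bigD1 j) //= (negbTE hj) mul0r mulr0 mul0r.
  rewrite [RHS](bigD1 j) //= /star_factor (negbTE jn).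
  case: ifP => _; last by rewrite mxE (negbTE hj) mul0r.
  by move: hj; rewrite mxE; case: (ket a j) => -[|[|]] //= ?;
    case: (ket b j) => -[|[|]] //= ?; rewrite mul0r.
rewrite big1 => [|j jn]; last by have /implyP/(_ jn) -> := ab j.
rewrite mulr1 -expiD.
(* Irreflexivity keeps [n] out of its own neighbourhood, so flipping qubit [n] changes exactly one
   sign in each term. *)
have -> : phase b = - phase a.
  rewrite /phase -sumrN; apply: eq_bigr => k kn; rewrite bn an sgn2_flip.
  have kn' : k != n by apply: contraTneq kn => ->; rewrite inE he.
  by have /implyP/(_ kn')/eqP -> := ab k; ring.
rewrite mulNr opprK -splitr.
transitivity (\prod_(k in neighbours e n) expi (sgn2 t * gamma n k * sgn2 (ket a k))).
  rewrite /phase (big_morph _ (@expiD R) (@expi0 R)).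
  by apply: eq_bigr => k _; rewrite an; congr expi; ring.
rewrite big_mkcond [LHS](bigD1 n) //= inE he mul1r.
apply: eq_bigr => j jn; rewrite /star_factor (negbTE jn).
have /implyP/(_ jn)/eqP <- := ab j.
case: ifP => _; last by rewrite mxE eqxx.
rewrite mxE; case: (ket a j) => -[|[|]] //= ?; rewrite /sgn2.
  by rewrite mulr1.
by rewrite expr1 mulrN1.
Qed.

End Star.

(** * Planes detected by the star-shaped block *)

Section StarPlane.
Variables (R : realType) (N : nat) (n : 'I_N) (e : rel 'I_N).
Variable gamma : 'I_N -> 'I_N -> R.
Hypothesis he : irreflexive e.
Hypothesis hgamma : forall k, k \in neighbours e n -> sin (gamma n k) <> 0.

(** Every neighbour carries a ladder operator or X: an identity there would contribute
    [2 * cos (gamma n k)], which can vanish even if the sine does not. *)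
Definition star_plane (S : {set 'I_N}) : plane_index N :=
  PlaneIndex (n |: S)%SET finset.set0 (neighbours e n :\: S)%SET.

Lemma star_plane_at (S : {set 'I_N}) : S \subset neighbours e n ->
  plane_at #|S|.+1 (star_plane S).
Proof.
move=> SA; have nA : n \notin neighbours e n by rewrite inE he.
have nS : n \notin S by apply: contra nA; apply: (fintype.subsetP SA).
apply/and4P; split=> /=.
- by rewrite disjoint_sym finset.disjoints_subset finset.sub0set.
- apply/pred0P => k /=; rewrite !inE; apply/negP => /andP[/orP[/eqP->|kS] /andP[kS' kA]].
    by rewrite he in kA.
  by rewrite kS in kS'.
- by rewrite finset.disjoints_subset finset.sub0set.
- by rewrite cards0 subr0 cardsU1 nS.
Qed.

Lemma star_plane_E (S : {set 'I_N}) : plane_E R (star_plane S) =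
  tens (fun j => (if j \in (n |: S)%SET then mx2 1 1 (- 1) (- 1) else 1%:M) *m
                 (if j \in (neighbours e n :\: S)%SET then pauli_mx R PauliX else 1%:M)).
Proof.
rewrite /plane_E /= big_set0 -[1]/(1%:M) mulmx1.
under eq_bigr do rewrite ladder_plusE.
by rewrite prod_local (prod_local _ (pauli_mx R PauliX)) tensM.
Qed.

Lemma layer_turn (b : 'I_N -> bool) : exists theta : 'rV[R]_(N * 3),
  rotation_layer theta = tens (fun j => if b j then turn R else 1%:M).
Proof.
have [theta h] := layer_angles (fun j k =>
  if k == 1 then (if b j then pi / 2 else 0) else 0 : R).
exists theta; rewrite rotation_layerE; apply: eq_tens => j.
by rewrite !h -euler0.
Qed.

Lemma expiN_neq (x : R) : sin x <> 0 -> expi (- x) - expi x != 0.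
Proof.
move=> sx; apply/negP; rewrite subr_eq0 /expi sinN => /eqP[_ /eqP].
by rewrite eq_sym -addr_eq0 -mulr2n mulrn_eq0 /= => /eqP.
Qed.

(** With suitable turns both summands of the conjugated observable are tensor products, so their
    traces against [plane_E] are products of one-qubit traces. *)
Lemma star_trace_neq0 (S : {set 'I_N}) : S \subset neighbours e n ->
  exists theta : 'rV[R]_(N * 3 + N * 3),
    \tr (observable (local_op R PauliZ n) (star_block e gamma n theta) *m
         plane_E R (star_plane S)) <> 0.
Proof.
move=> SA; have nA : n \notin neighbours e n by rewrite inE he.
have nS : n \notin S by apply: contra nA; apply: (fintype.subsetP SA).
have [post hpost] := layer_turn (fun j => j == n).
(* Qubit [n] is turned so that its ladder operator sees an off-diagonal entry, and the neighbours
   carrying X so that X sees a diagonal matrix. Neighbours in [S] stay unturned: against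
   [ladder_plus] a diagonal matrix already has the difference of its entries as trace. *)
pose b j := (j == n) || (j \in (neighbours e n :\: S)%SET).
have [pre hpre] := layer_turn b.
exists (row_mx post pre); rewrite star_plane_E.
set E := fun j => _ *m _.
pose B j : 'M[R[i]]_2 := if b j then turn R else 1%:M.
have -> : observable (local_op R PauliZ n) (star_block e gamma n (row_mx post pre)) =
    - \sum_(t : 'I_2) tens (fun j => (B j) ^t* *m star_factor n e gamma t j *m B j).
  rewrite /observable /star_block row_mxKl row_mxKr hpost hpre.
  rewrite -[tens (fun j => if j == n then _ else _)]/(local (turn R) n).
  rewrite -[local_op R PauliZ n]/(local (pauli_mx R PauliZ) n) !adjM.
  transitivity ((tens B) ^t* *m ((entangler e gamma n) ^t* *m
      ((local (turn R) n) ^t* *m local (pauli_mx R PauliZ) n *m local (turn R) n) *m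
      entangler e gamma n) *m tens B); first by rewrite !mulmxA.
  have -> : (local (turn R) n) ^t* = local ((turn R) ^t*) n.
    rewrite tens_adj; apply: eq_tens => j; case: eqP => // _.
    by rewrite trmx1 map_mx1.
  rewrite !localM turn_Z.
  have -> : - pauli_mx R PauliX = \sum_(t : 'I_2) (-1) *: delta_mx t (1 - t).
    by rewrite !big_ord_recl big_ord0 addr0 [RHS]mx2_eta !mxE /= mx2N !mulr0 !mulr1
      ?addr0 ?add0r ?oppr0.
  have -> : local (\sum_(t : 'I_2) (-1) *: delta_mx t (1 - t) : 'M[R[i]]_2) n =
      - \sum_(t : 'I_2) local (delta_mx t (1 - t)) n.
    by rewrite !big_ord_recl !big_ord0 !addr0 localD !localZ !scaleN1r opprD.
  rewrite mulmxN mulNmx mulmxN mulNmx; congr (- _).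
  rewrite mulmx_sumr !mulmx_suml mulmx_sumr mulmx_suml; apply: eq_bigr => t _.
  by rewrite entangler_local // tens_adj !tensM.
rewrite mulNmx mulmx_suml raddfN /= tr_sum.
apply/eqP; rewrite oppr_eq0.
have trE t : \tr (tens (fun j => (B j) ^t* *m star_factor n e gamma t j *m B j) *m tens E) =
    \prod_j \tr ((B j) ^t* *m star_factor n e gamma t j *m B j *m E j).
  by rewrite tensM tr_tens.
under eq_bigr do rewrite trE.
have En : E n = mx2 1 1 (- 1) (- 1) by rewrite /E !inE eqxx he andbF mulmx1.
have Bn : B n = turn R by rewrite /B /b eqxx.
have tn t : \tr ((B n) ^t* *m star_factor n e gamma t n *m B n *m E n) =
    2 * (delta_mx t (1 - t) : 'M[R[i]]_2) 1 0.
  by rewrite En Bn /star_factor eqxx [delta_mx _ _]mx2_eta turn_plus -mx2_eta.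
(* The summand [t = 0] dies at qubit [n], since |0><1| has no entry in row 1, column 0; the summand
   [t = 1] has the factor 2 there. *)
rewrite big_ord_recl big_ord1 [X in X + _](_ : _ = 0) ?add0r; last first.
  by apply/eqP/prodf_eq0; exists n; rewrite // tn mxE mulr0.
apply/prodf_neq0 => j _; have [->|jn] := eqVneq j n.
  by rewrite tn mxE mulr1 pnatr_eq0.
rewrite /star_factor (negbTE jn).
have -> : sgn2 R (lift ord0 ord0) = -1 by rewrite /sgn2 expr1.
rewrite mulN1r opprK /B /b (negbTE jn) orFb /E !inE (negbTE jn) /=.
have jA : (j \in neighbours e n) = e n j by rewrite inE.
rewrite -jA; have [jS|jS] := boolP (j \in S) => /=.
  have jA' := fintype.subsetP SA _ jS; rewrite jA' trmx1 map_mx1 !mulmx1 mul1mx mx2M mx2_tr.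
  rewrite !mul0r !mulr1 addr0 add0r mulrN1.
  by apply: expiN_neq; exact: hgamma.
have [jA'|jA'] := boolP (j \in neighbours e n).
  by rewrite mul1mx turn_X -oppr_eq0 opprB; apply: expiN_neq; exact: hgamma.
by rewrite trmx1 map_mx1 !mulmx1 mxtrace1 pnatr_eq0.
Qed.

Lemma trigmx_star_block : trigmx (star_block e gamma n).
Proof.
apply: trigmxM; first apply: trigmxM.
- by apply: trigmx_lsub; exact: trigmx_layer.
- exact: trigmx_cst.
- by apply: trigmx_rsub; exact: trigmx_layer.
Qed.

End StarPlane.

(** * From one nonzero plane vector to almost every parameter setting *)

Lemma observable_adj (R : realType) N (M W : operator R N) :
  M ^t* = M -> (observable M W) ^t* = observable M W.
Proof. by move=> hM; rewrite /observable !adjM adjK hM mulmxA. Qed.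

Lemma exists_subset_card (T : finType) (A : {set T}) k : (k <= #|A|)%N ->
  exists2 S : {set T}, S \subset A & #|S| = k.
Proof.
move=> kA; exists [set x in take k (enum A)]%SET.
  by apply/fintype.subsetP => x; rewrite inE => /mem_take; rewrite mem_enum.
rewrite cardsE; have /card_uniqP -> := take_uniq k (enum_uniq A).
by rewrite size_takel // -cardE.
Qed.

Theorem corollary1 (R : realType) (N : nat)
    (phi : 'I_N -> 'cV[R[i]]_2)
    (hphi : forall j : 'I_N, (phi j) ^t* *m phi j = 1%:M)
    (pV : nat) (V : seq (gate R N pV)) :
  (* (a) *)
  (forall (pL : nat) (CL : seq (gate R N pL))
      (M : 'M[R[i]]_(hdim N)) (hM : M \is hermsymmx)
      (c : 'rV[R]_(pL + (N * 3 + pV)) -> int -> R[i])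
      (hc : forall Theta : 'rV[R]_(pL + (N * 3 + pV)),
          fourier_expansion N
            (output (product_state phi) M (circuit_op CL (lsubmx Theta))
               (state_block V (rsubmx Theta)))
            (c Theta))
      (w : nat) (hw : (1 <= w <= N)%N),
      (exists (Theta : 'rV[R]_(pL + (N * 3 + pV))) (r : plane_index N),
          plane_at w r /\
          bvec (observable M (circuit_op CL (lsubmx Theta))) r <> 0) ->
      almost_every
        (fun Theta : 'rV[R]_(pL + (N * 3 + pV)) => c Theta w%:Z <> 0))
  /\
  (* (b) *)
  (forall (n : 'I_N) (e : rel 'I_N)
      (he_sym : symmetric e) (he_irr : irreflexive e)
      (gamma : 'I_N -> 'I_N -> R)
      (hgamma : forall k : 'I_N, k \in neighbours e n -> sin (gamma n k) <> 0)
      (c : 'rV[R]_((N * 3 + N * 3) + (N * 3 + pV)) -> int -> R[i])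
      (hc : forall Theta : 'rV[R]_((N * 3 + N * 3) + (N * 3 + pV)),
          fourier_expansion N
            (output (product_state phi) (local_op R PauliZ n)
               (star_block e gamma n (lsubmx Theta))
               (state_block V (rsubmx Theta)))
            (c Theta))
      (w : nat) (hw : (1 <= w <= #|neighbours e n| + 1)%N),
      (exists (Theta : 'rV[R]_((N * 3 + N * 3) + (N * 3 + pV)))
              (r : plane_index N),
          plane_at w r /\
          bvec (observable (local_op R PauliZ n)
                  (star_block e gamma n (lsubmx Theta))) r <> 0)
      /\
      almost_every
        (fun Theta : 'rV[R]_((N * 3 + N * 3) + (N * 3 + pV)) =>
           c Theta w%:Z <> 0)).
Proof.
split.
  move=> pL CL M hM c hc w /andP[_ wN]; case=> Theta [r [rw hb]].
  apply: (coefficient_almost_every (WL := circuit_op CL) _ hphi hc wN).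
    exact: trigmx_circuit.
  exists (lsubmx Theta), r; split=> //; apply: bvec_trace hb.
  apply: observable_adj; move/is_hermitianmxP: hM => hM.
  by rewrite [RHS]hM expr0 scale1r.
move=> n e _ he gamma hgamma c hc w /andP[w1 wd].
have hZ : (local_op R PauliZ n) ^t* = local_op R PauliZ n.
  rewrite tens_adj; apply: eq_tens => j; case: eqP => _.
    exact: pauli_herm.
  by rewrite trmx1 map_mx1.
(* Qubit [n] supplies one unit of frequency, so [w.-1] neighbours supply the rest. *)
have [S SA Sw] : exists2 S : {set 'I_N}, S \subset neighbours e n & #|S| = w.-1.
  by apply: exists_subset_card; rewrite -ltnS prednK // -addn1.
have rw : plane_at w (star_plane n e S).
  by have := star_plane_at he SA; rewrite Sw prednK.
have [theta ht] := star_trace_neq0 he hgamma SA.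
(* As [n] is not its own neighbour, the star has [#|neighbours e n| + 1] qubits, hence at most
   [N]. *)
have wN : (w <= N)%N.
  apply: leq_trans wd _; rewrite addn1 -[leqRHS]card_ord -cardsT.
  by apply: proper_card; apply/properP; split;
    [exact: finset.subsetT | exists n; rewrite ?inE ?he].
split.
  exists (row_mx theta 0), (star_plane n e S); rewrite row_mxKl; split=> //.
  by apply: trace_bvec; rewrite observable_adj.
apply: (coefficient_almost_every (WL := star_block e gamma n) _ hphi hc wN).
  exact: trigmx_star_block.
by exists theta, (star_plane n e S).
Qed.
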